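(* Let $\Phi=\bigcap_{x\in X}B(x,h)\subset\mathbb{R}^3$ be a Reuleaux polyhedron. Let $\Sigma(\Phi)$ be the surface obtained from $\partial\Phi$ by choosing one edge from each pair of dual edges of $G_\Phi$ and performing surgery on each chosen edge. Then $\Sigma(\Phi)$ is the boundary of a convex body of constant width $h$.
   Context: $B(x,h)$, $S(x,h)$ denote the closed ball and sphere of radius $h$ centered at $x$. A ball polyhedron in $\mathbb{R}^3$ is a finite intersection (at least $3$) of closed balls of radius $h>0$; for $\Phi=\bigcap_{x\in X}B(x,h)$ with nonempty interior and no redundant ball, a boundary point $y$ is $0$-singular if there are $x_1,x_2,x_3\in X\cap S(y,h)$ with $x_1-y,x_2-y,x_3-y$ linearly independent. The singular boundary points form an embedded graph $G_\Phi$ whose vertices are the $0$-singular points and whose edges are circular arcs $\widetilde{ab}$ joining pairs of vertices; the faces of $\Phi$ are the sets $\tau(x)=S(x,h)\cap\Phi$, $x\in X$. $\Phi$ is standard if any two faces intersect in the empty set, a single vertex or a single edge. A Reuleaux polyhedron is a standard ball polyhedron $\bigcap_{x\in X}B(x,h)$ whose set of $0$-singular boundary points is exactly $X$. In a Reuleaux polyhedron, each edge $\widetilde{xy}$ (with endpoints $x,y\in X$) has a dual edge $\widetilde{ab}$, where $a,b\in X$ are such that $\widetilde{xy}=\tau(a)\cap\tau(b)$; then $d(x,a)=d(x,b)=d(y,a)=d(y,b)=h$, $\widetilde{xy}\subset S(a,h)\cap S(b,h)$ and $\widetilde{ab}\subset S(x,h)\cap S(y,h)$; $\{\widetilde{xy},\widetilde{ab}\}$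 is a pair of dual edges. Surgery on the edge $\widetilde{xy}$ with dual edge $\widetilde{ab}$: let $\Sigma_a\subset S(a,h)$ and $\Sigma_b\subset S(b,h)$ be the shortest geodesics joining $x$ and $y$ on these spheres; let $\Sigma(xy)$ be the region of $\partial\Phi$ between $\Sigma_a$ and $\Sigma_b$ (containing $\widetilde{xy}$); let the wedge $W(x,y)$ be the surface of revolution with axis the line through $x,y$ lying between $\Sigma_a$ and $\Sigma_b$, i.e. the union of the shorter circular arcs of radius $h$ from $x$ to $y$ whose centers are points of $\widetilde{ab}$. Surgery replaces $\Sigma(xy)$ by $W(x,y)$ in the boundary. A convex body has constant width $h$ if the distance between every pair of parallel supporting planes is $h$. *)

(* Defs.v *)
From Stdlib Require Import Reals List.
Open Scope R_scope.

Definition pt := (R * R * R)%type.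
Definition pset := pt -> Prop.

Definition vzero : pt := (0, 0, 0).
Definition vadd (u v : pt) : pt :=
  let '(a1, a2, a3) := u in let '(b1, b2, b3) := v in (a1 + b1, a2 + b2, a3 + b3).
Definition vscal (k : R) (u : pt) : pt :=
  let '(a1, a2, a3) := u in (k * a1, k * a2, k * a3).
Definition vopp (u : pt) : pt := vscal (-1) u.
Definition vsub (u v : pt) : pt := vadd u (vopp v).
Definition dot (u v : pt) : R :=
  let '(a1, a2, a3) := u in let '(b1, b2, b3) := v in a1 * b1 + a2 * b2 + a3 * b3.
Definition vnorm (u : pt) : R := sqrt (dot u u).
Definition dist (p q : pt) : R := vnorm (vsub p q).
Definition normalize (u : pt) : pt := vscal (/ vnorm u) u.

Definition cball (x : pt) (r : R) : pset := fun y => dist x y <= r.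
Definition sphere (x : pt) (r : R) : pset := fun y => dist x y = r.
Definition oball (x : pt) (r : R) : pset := fun y => dist x y < r.

Definition interior (A : pset) : pset :=
  fun y => exists e, 0 < e /\ forall z, oball y e z -> A z.
Definition closure (A : pset) : pset :=
  fun y => forall e, 0 < e -> exists z, A z /\ oball y e z.
Definition boundary (A : pset) : pset :=
  fun y => closure A y /\ ~ interior A y.

Definition cont_on01 (g : R -> pt) : Prop :=
  forall t, 0 <= t <= 1 -> forall e, 0 < e -> exists d, 0 < d /\
    forall s, 0 <= s <= 1 -> Rabs (s - t) < d -> dist (g s) (g t) < e.

Definition path_in (S : pset) (p q : pt) : Prop :=
  exists g : R -> pt, cont_on01 g /\ g 0 = p /\ g 1 = q /\
    forall t, 0 <= t <= 1 -> S (g t).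

Definition is_arc (A : pset) (p q : pt) : Prop :=
  exists (g : R -> pt) (c n : pt) (r : R),
    cont_on01 g /\
    (forall s t, 0 <= s <= 1 -> 0 <= t <= 1 -> g s = g t -> s = t) /\
    g 0 = p /\ g 1 = q /\
    (forall z, A z <-> exists t, 0 <= t <= 1 /\ z = g t) /\
    0 < r /\ n <> vzero /\
    (forall t, 0 <= t <= 1 -> dist c (g t) = r /\ dot n (vsub (g t) c) = 0).

Definition lin_indep3 (u v w : pt) : Prop :=
  forall a b c, vadd (vadd (vscal a u) (vscal b v)) (vscal c w) = vzero ->
    a = 0 /\ b = 0 /\ c = 0.

Definition ball_poly (X : list pt) (h : R) : pset :=
  fun y => forall x, In x X -> cball x h y.

Definition is_ball_polyhedron (X : list pt) (h : R) : Prop :=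
  0 < h /\ NoDup X /\ (3 <= length X)%nat /\
  (exists y, interior (ball_poly X h) y) /\
  (forall x, In x X -> exists y,
      (forall x', In x' X -> x' <> x -> cball x' h y) /\ ~ cball x h y).

Definition face (X : list pt) (h : R) (x : pt) : pset :=
  fun y => sphere x h y /\ ball_poly X h y.

Definition zero_singular (X : list pt) (h : R) (y : pt) : Prop :=
  boundary (ball_poly X h) y /\
  exists x1 x2 x3, In x1 X /\ In x2 X /\ In x3 X /\
    sphere y h x1 /\ sphere y h x2 /\ sphere y h x3 /\
    lin_indep3 (vsub x1 y) (vsub x2 y) (vsub x3 y).

Definition singular (X : list pt) (h : R) (y : pt) : Prop :=
  boundary (ball_poly X h) y /\
  exists x1 x2, In x1 X /\ In x2 X /\ x1 <> x2 /\ sphere x1 h y /\ sphere x2 h y.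

Definition is_edge (X : list pt) (h : R) (E : pset) (x y : pt) : Prop :=
  is_arc E x y /\ zero_singular X h x /\ zero_singular X h y /\
  (forall z, E z -> singular X h z) /\
  (forall z, E z -> z <> x -> z <> y -> ~ zero_singular X h z).

Definition is_standard (X : list pt) (h : R) : Prop :=
  is_ball_polyhedron X h /\
  forall a b, In a X -> In b X -> a <> b ->
    (forall z, ~ (face X h a z /\ face X h b z)) \/
    (exists v, zero_singular X h v /\
       forall z, (face X h a z /\ face X h b z) <-> z = v) \/
    (exists x y, is_edge X h (fun z => face X h a z /\ face X h b z) x y).

Definition is_reuleaux (X : list pt) (h : R) : Prop :=
  is_standard X h /\ forall y, zero_singular X h y <-> In y X.

Definition dual_data (X : list pt) (h : R) (E : pset) (x y : pt)
    (F : pset) (a b : pt) : Prop :=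
  is_edge X h E x y /\ is_edge X h F a b /\ In a X /\ In b X /\
  forall z, E z <-> (face X h a z /\ face X h b z).

Definition dual (X : list pt) (h : R) (E F : pset) : Prop :=
  exists x y a b, dual_data X h E x y F a b.

Definition dual_selection (X : list pt) (h : R) (C : pset -> Prop) : Prop :=
  (forall E, C E -> exists x y, is_edge X h E x y) /\
  (forall E F, dual X h E F -> (C E <-> ~ C F)).

(* shorter great-circle arc of S(c,h) from x to y (shortest geodesic on S(c,h));
   equally: the shorter circular arc of radius h centred at c from x to y *)
Definition minor_arc (c x y : pt) (h : R) : pset :=
  fun p => exists t, 0 <= t <= 1 /\
    p = vadd c (vscal h (normalize (vadd (vscal (1 - t) (vsub x c))
                                        (vscal t (vsub y c))))).

(* Sigma(xy): closed region of the boundary between Sigma_a and Sigma_b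
   containing the edge E *)
Definition sigma_region (X : list pt) (h : R) (E : pset) (x y a b : pt) : pset :=
  let S := fun z => boundary (ball_poly X h) z /\
             ~ minor_arc a x y h z /\ ~ minor_arc b x y h z in
  closure (fun p => exists e, E e /\ path_in S e p).

Definition wedge (h : R) (F : pset) (x y : pt) : pset :=
  fun p => exists c, F c /\ minor_arc c x y h p.

Definition surgered (X : list pt) (h : R) (C : pset -> Prop) : pset :=
  fun p =>
    (boundary (ball_poly X h) p /\
      forall E x y F a b, C E -> dual_data X h E x y F a b ->
        ~ sigma_region X h E x y a b p) \/
    (exists E x y F a b, C E /\ dual_data X h E x y F a b /\ wedge h F x y p).

Definition convex (K : pset) : Prop :=
  forall p q t, K p -> K q -> 0 <= t <= 1 ->
    K (vadd (vscal (1 - t) p) (vscal t q)).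

Definition convex_body (K : pset) : Prop :=
  convex K /\ (forall p, closure K p -> K p) /\
  (exists M, forall p, K p -> vnorm p <= M) /\
  (exists p, interior K p).

Definition supporting_plane (K : pset) (u : pt) (c : R) : Prop :=
  (forall p, K p -> dot u p <= c) /\ exists p, K p /\ dot u p = c.

Definition constant_width (K : pset) (h : R) : Prop :=
  forall u c1 c2, vnorm u = 1 ->
    supporting_plane K u c1 -> supporting_plane K (vopp u) (- c2) ->
    c1 - c2 = h.

(* Main.v *)
(* The body is [K = ⋂ B(c, h)] over the vertices [c] of [Phi] and the points [c] of the edges on
   which no surgery is performed. An intersection of balls of radius [h] whose centres belong to
   it and whose diameter is at most [h] has constant width [h], so what matters is [diam K <= h].

   A pair of dual edges sits in a frame where everything is explicit: opposite to the dihedral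
   angle at the line [xy] spanned by [a] and [b] lies a dihedral angle [D] such that
   [∂Phi ∩ D] is the region [Sigma(xy)], only the spheres of [a] and [b] contribute to it, and
   [D] contains every point of [B(a, h) ∩ B(b, h)] cut off by a ball centred on the dual edge.
   Hence distinct unmodified edges do not interfere, and [K] differs from [Phi] exactly by the
   wedges.

   If [p], [u], [v] lie on [S(c, h)], [p - c] is a nonnegative combination of [u - c] and [v - c],
   and [u], [v] are within [h] of [q], then so is [p]. Every boundary point of [K] that is not a
   centre is of this kind, with [u] and [v] centres of [K], or points of minor arcs between them;
   so it is within [h] of all of [K], and so is [K] itself. *)
From Stdlib Require Import Reals List Lra Lia Psatz.
From Stdlib Require Import Classical ClassicalDescription FunctionalExtensionality PropExtensionality.
Require Import Defs.
Open Scope R_scope.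

(** The definitions give an edge only as some embedded circular arc and the region Sigma(xy) only as
    the closure of a set of points joined to the edge by paths, whereas the estimates need
    inequalities. An edge is identified, by the intermediate value theorem, with an explicit arc
    that is a graph over the coordinate along [xy], and membership in the removed region is read off
    the sign of one Lipschitz function, [dihedral_gap]. Standardness is used in two ways: faces
    sharing two points share an edge, which yields the dual edge, and away from the vertices only
    two spheres meet ([two_spheres]), which keeps the surgeries apart. The centres of K fill whole
    arcs, so it takes compactness to see that a boundary point of K lies on one of the spheres.
    Balls centred on the dual edge cut inside the dihedral angle because the squared distance from a
    fixed point to the dual arc is, up to a constant, a linear function on an arc of an ellipse, and
    its maximum is found by Cauchy-Schwarz. Distances mostly enter squared, which keeps the
    estimates polynomial. *)

(** * Vector algebra and squared distances *)

Definition sqdist (p q : pt) : R := dot (vsub p q) (vsub p q).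

(** For [u], [v] on a sphere about [c], nonnegative [l], [m] and a result on the same sphere
    describe the shorter great-circle arc from [u] to [v], without the normalisation built into
    [minor_arc]. *)
Definition comb (c u v : pt) (l m : R) : pt :=
  vadd c (vadd (vscal l (vsub u c)) (vscal m (vsub v c))).

Definition seg (p q : pt) (t : R) : pt := vadd (vscal (1 - t) p) (vscal t q).

Ltac dpt := repeat match goal with p : pt |- _ => destruct p as [[? ?] ?] end.
Ltac vunf := unfold sqdist, seg, comb, vsub, vopp, vadd, vscal, dot, vzero in *.
Ltac vring := intros; dpt; vunf; ring.
Ltac veq := intros; dpt; vunf; apply f_equal2; [apply f_equal2|]; ring.

Lemma pt_eq_or_neq (p q : pt) : p = q \/ p <> q.
Proof. apply classic. Qed.

Lemma dot_sym (u v : pt) : dot u v = dot v u.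
Proof. vring. Qed.

Lemma dot_self_nonneg (u : pt) : 0 <= dot u u.
Proof. dpt; vunf; nra. Qed.

Lemma dot_self_eq0 (u : pt) : dot u u = 0 -> u = vzero.
Proof.
  intros H; destruct u as [[x y] z]; unfold dot, vzero in *.
  assert (x = 0) by nra. assert (y = 0) by nra. assert (z = 0) by nra. now subst.
Qed.

Lemma sqdist_nonneg (p q : pt) : 0 <= sqdist p q.
Proof. apply dot_self_nonneg. Qed.

Lemma sqdist_sym (p q : pt) : sqdist p q = sqdist q p.
Proof. vring. Qed.

Lemma vsub_eq0 (p q : pt) : vsub p q = vzero -> p = q.
Proof.
  intros H; dpt; unfold vsub, vopp, vscal, vadd, vzero in H; injection H; intros.
  f_equal; [f_equal|]; lra.
Qed.

Lemma sqdist_eq0 (p q : pt) : sqdist p q = 0 -> p = q.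
Proof. intros H; apply vsub_eq0, dot_self_eq0, H. Qed.

Lemma sqdist_refl (p : pt) : sqdist p p = 0.
Proof. vring. Qed.

Lemma sqdist_pos (p q : pt) : p <> q -> 0 < sqdist p q.
Proof.
  intros H; destruct (Rle_lt_or_eq_dec 0 (sqdist p q) (sqdist_nonneg p q)); auto.
  exfalso; apply H, sqdist_eq0; auto.
Qed.

Lemma dist_sqdist (p q : pt) : dist p q * dist p q = sqdist p q.
Proof. apply sqrt_sqrt, sqdist_nonneg. Qed.

Lemma dist_nonneg (p q : pt) : 0 <= dist p q.
Proof. apply sqrt_pos. Qed.

Lemma dist_le_iff (p q : pt) (r : R) : 0 <= r -> (dist p q <= r <-> sqdist p q <= r * r).
Proof.
  intros Hr; pose proof (dist_sqdist p q); pose proof (dist_nonneg p q); split; intros; nra.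
Qed.

Lemma dist_lt_iff (p q : pt) (r : R) : 0 <= r -> (dist p q < r <-> sqdist p q < r * r).
Proof.
  intros Hr; pose proof (dist_sqdist p q); pose proof (dist_nonneg p q); split; intros; nra.
Qed.

Lemma dist_eq_iff (p q : pt) (r : R) : 0 <= r -> (dist p q = r <-> sqdist p q = r * r).
Proof.
  intros Hr; pose proof (dist_sqdist p q); pose proof (dist_nonneg p q); split; intros; nra.
Qed.

Lemma dist_sym (p q : pt) : dist p q = dist q p.
Proof. unfold dist, vnorm; f_equal; apply sqdist_sym. Qed.

Lemma cauchy_schwarz (u v : pt) : dot u v * dot u v <= dot u u * dot v v.
Proof.
  destruct u as [[a1 a2] a3], v as [[b1 b2] b3]; unfold dot.
  pose proof (Rle_0_sqr (a1*b2-a2*b1)); pose proof (Rle_0_sqr (a1*b3-a3*b1));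
  pose proof (Rle_0_sqr (a2*b3-a3*b2)); unfold Rsqr in *; nra.
Qed.

Lemma dist_triangle (p q r : pt) : dist p r <= dist p q + dist q r.
Proof.
  apply dist_le_iff.
  { pose proof (dist_nonneg p q); pose proof (dist_nonneg q r); lra. }
  pose proof (cauchy_schwarz (vsub p q) (vsub q r)) as CS.
  fold (sqdist p q) (sqdist q r) in CS.
  replace (sqdist p r) with (sqdist p q + sqdist q r + 2 * dot (vsub p q) (vsub q r)) by vring.
  rewrite <- !dist_sqdist in *.
  pose proof (dist_nonneg p q); pose proof (dist_nonneg q r).
  assert (dot (vsub p q) (vsub q r) <= dist p q * dist q r); [|nra].
  assert (0 <= dist p q * dist q r) by nra.
  nra.
Qed.

Lemma cball_sqdist (h : R) (x y : pt) : 0 < h -> (cball x h y <-> sqdist x y <= h * h).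
Proof. intros; apply dist_le_iff; lra. Qed.

Lemma sphere_sqdist (h : R) (x y : pt) : 0 < h -> (sphere x h y <-> sqdist x y = h * h).
Proof. intros; apply dist_eq_iff; lra. Qed.

(** The difference of the squared distances to [q] and to [c] is an affine function of the point, so
    its values at [u], [v] and [c] determine it on their plane. *)
Lemma sqdist_comb (c u v q : pt) (l m : R) :
  sqdist (comb c u v l m) q =
  sqdist (comb c u v l m) c + l * (sqdist u q - sqdist u c) + m * (sqdist v q - sqdist v c)
  + (1 - l - m) * sqdist c q.
Proof. unfold comb; vring. Qed.

Lemma sqdist_comb_c (c u v : pt) (l m : R) :
  sqdist (comb c u v l m) c = (l + m) * (l * sqdist u c + m * sqdist v c) - l * m * sqdist u v.
Proof. unfold comb; vring. Qed.

(* As the point is on the sphere, beyond the chord [uv], we have [l + m >= 1]. The half-space that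
   [B(q)] cuts out of the sphere excludes [c] and contains [u] and [v], hence the point. *)
Lemma fan (r : R) (c u v q : pt) (l m : R) :
  0 < r -> 0 <= l -> 0 <= m -> sqdist u c = r -> sqdist v c = r ->
  sqdist (comb c u v l m) c = r -> sqdist u q <= r -> sqdist v q <= r ->
  sqdist (comb c u v l m) q <= r.
Proof.
  intros Hr Hl Hm Hu Hv Hp Huq Hvq.
  assert (1 <= l + m).
  { pose proof (sqdist_comb_c c u v l m) as E. rewrite Hp, Hu, Hv in E.
    pose proof (sqdist_nonneg u v).
    assert (0 <= l * m * sqdist u v) by (apply Rmult_le_pos; [nra|auto]).
    assert (r <= (l+m)*(l+m)*r) by nra.
    assert (1 <= (l+m)*(l+m)) by (apply Rmult_le_reg_r with r; lra). nra. }
  rewrite sqdist_comb, Hp, Hu, Hv. pose proof (sqdist_nonneg c q). nra.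
Qed.

(** Stewart's theorem. *)
Lemma sqdist_seg (p q c : pt) (t : R) :
  sqdist (seg p q t) c = (1 - t) * sqdist p c + t * sqdist q c - t * (1 - t) * sqdist p q.
Proof. unfold seg; vring. Qed.

(** * Intersections of balls of equal radius *)

(** Unlike the list of [ball_poly], the set [Y] may be infinite: the centres of the surgered body
    fill whole arcs. *)
Definition hull (h : R) (Y : pset) : pset := fun p => forall c, Y c -> sqdist p c <= h * h.

Lemma hull_convex (h : R) (Y : pset) : convex (hull h Y).
Proof.
  intros p q t Hp Hq Ht c Hc. specialize (Hp c Hc); specialize (Hq c Hc).
  fold (seg p q t). rewrite sqdist_seg.
  assert (0 <= t * (1 - t) * sqdist p q) by (apply Rmult_le_pos; [nra|apply sqdist_nonneg]). nra.
Qed.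

Lemma dist_shrink (h : R) (p z c : pt) :
  dist p z <= h - dist p c -> dist z c <= h.
Proof. intros H; pose proof (dist_triangle z p c). rewrite (dist_sym z p) in *. lra. Qed.

Lemma hull_open_compl (h : R) (Y : pset) (p : pt) : 0 < h -> ~ hull h Y p ->
  exists e, 0 < e /\ forall z, dist p z < e -> ~ hull h Y z.
Proof.
  intros Hh Hn. apply not_all_ex_not in Hn as [c Hc]. apply imply_to_and in Hc as [Yc Hc].
  assert (Hpc : h < dist p c).
  { apply Rnot_le_lt; intros H; apply Hc, dist_le_iff; lra. }
  exists (dist p c - h); split; [lra|]. intros z Hz HK.
  specialize (HK c Yc). apply dist_le_iff in HK; [|lra].
  pose proof (dist_triangle p z c). lra.
Qed.

Lemma hull_closed (h : R) (Y : pset) (p : pt) : 0 < h -> closure (hull h Y) p -> hull h Y p.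
Proof.
  intros Hh Hcl. apply NNPP; intros Hn.
  destruct (hull_open_compl h Y p Hh Hn) as [e [He Hz]].
  destruct (Hcl e He) as [z [Kz Bz]]. now apply (Hz z Bz).
Qed.

Lemma closure_incl (A : pset) (p : pt) : A p -> closure A p.
Proof.
  intros Hp e He; exists p; split; auto. unfold oball. apply dist_lt_iff; [lra|].
  rewrite sqdist_refl; nra.
Qed.

Lemma hull_sphere_boundary (h : R) (Y : pset) (p c : pt) :
  0 < h -> hull h Y p -> Y c -> sqdist p c = h * h -> boundary (hull h Y) p.
Proof.
  intros Hh Kp Yc Hpc. split; [now apply closure_incl|].
  intros [e [He HI]].
  (* This point is [p] moved by [e / 2] straight away from [c], hence out of the ball of [c]. *)
  assert (K : hull h Y (vadd p (vscal (e / (2 * h)) (vsub p c)))).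
  { apply HI. unfold oball. apply dist_lt_iff; [lra|].
    replace (sqdist p (vadd p (vscal (e / (2 * h)) (vsub p c))))
      with ((e / (2*h)) * (e / (2*h)) * sqdist p c) by vring.
    rewrite Hpc. replace (e / (2 * h) * (e / (2 * h)) * (h * h)) with (e * e / 4)
      by (field; lra). nra. }
  specialize (K c Yc).
  replace (sqdist (vadd p (vscal (e / (2 * h)) (vsub p c))) c)
    with ((1 + e / (2*h)) * (1 + e / (2*h)) * sqdist p c) in K by vring.
  rewrite Hpc in K.
  assert (0 < e / (2 * h)) by (apply Rdiv_lt_0_compat; lra).
  assert (0 < h * h) by nra. nra.
Qed.

Lemma boundary_hull_in (h : R) (Y : pset) (p : pt) :
  0 < h -> boundary (hull h Y) p -> hull h Y p.
Proof. intros Hh [Hc _]; now apply hull_closed. Qed.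

Lemma ball_poly_hull (X : list pt) (h : R) : 0 < h -> ball_poly X h = hull h (fun c => In c X).
Proof.
  intros Hh. apply functional_extensionality; intros p; apply propositional_extensionality.
  unfold ball_poly, hull; split; intros H c Hc; specialize (H c Hc);
    [rewrite sqdist_sym; apply (cball_sqdist h c p Hh); auto | apply cball_sqdist; auto; rewrite
        sqdist_sym; auto].
Qed.

(** The minimum of finitely many margins serves all elements, since [P] is monotone in the
    margin. *)
Lemma list_margin (P : pt -> R -> Prop) (L : list pt) :
  (forall c e e', In c L -> e' <= e -> P c e -> P c e') ->
  (forall c, In c L -> exists e, 0 < e /\ P c e) ->
  exists e, 0 < e /\ forall c, In c L -> P c e.
Proof.
  induction L as [|x L IH]; intros Hm He.
  - exists 1; split; [lra|]. intros c [].
  - destruct IH as [e1 [He1 H1]].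
    { intros c e e' Hc; apply Hm; now right. } { intros c Hc; apply He; now right. }
    destruct (He x (or_introl eq_refl)) as [e2 [He2 H2]].
    exists (Rmin e1 e2); split; [now apply Rmin_pos|].
    intros c [Hc|Hc].
    + subst; apply (Hm c e2); auto; [now left | apply Rmin_r].
    + apply (Hm c e1); auto; [now right | apply Rmin_l].
Qed.

(** Spheres through [p] are exempted, so the margin is available at boundary points: near [p] no
    sphere is met that does not already pass through [p]. *)
Lemma finite_strict_margin (X : list pt) (h : R) (p : pt) : 0 < h ->
  exists e, 0 < e /\ forall c, In c X -> sqdist p c < h * h -> 
    forall z, dist p z < e -> sqdist z c < h * h.
Proof.
  intros Hh.
  apply (list_margin (fun c e => sqdist p c < h * h -> forall z, dist p z < e -> sqdist z c < h *
      h)).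
  - intros c e e' _ Hle H Hs z Hz; apply H; auto; lra.
  - intros c _. destruct (Rlt_le_dec (sqdist p c) (h * h)) as [Hlt|Hge].
    + apply dist_lt_iff in Hlt; [|lra]. exists (h - dist p c); split; [lra|].
      intros _ z Hz. apply dist_lt_iff; [lra|].
      pose proof (dist_triangle z p c). rewrite (dist_sym z p) in *. lra.
    + exists 1; split; [lra|]. intros; lra.
Qed.

Lemma boundary_finite_hull (X : list pt) (h : R) (p : pt) : 0 < h ->
  (boundary (hull h (fun c => In c X)) p <->
   hull h (fun c => In c X) p /\ exists c, In c X /\ sqdist p c = h * h).
Proof.
  intros Hh; split.
  - intros Hb. assert (Kp := boundary_hull_in _ _ _ Hh Hb). split; auto.
    apply NNPP; intros Hn. destruct Hb as [_ Hi]; apply Hi.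
    destruct (finite_strict_margin X h p Hh) as [e [He H]]. exists e; split; auto.
    intros z Hz c Hc. apply Rlt_le, H; auto.
    destruct (Rle_lt_or_eq_dec _ _ (Kp c Hc)); auto.
    exfalso; apply Hn; eauto.
  - intros [Kp [c [Hc E]]]. now apply hull_sphere_boundary with c.
Qed.

(** * Constant width *)

(** The ball of radius [h] that touches the supporting plane at [p] from the side of the hull
    contains the whole hull. A point [q] outside it has [d + 2 h w > 0]. Raising the segment from
    [p] to [q] along a parabola of the curvature that balls of radius [h] permit keeps it in the
    hull, and its height [t (w + (1 - t) d / (2 h))] above the plane becomes positive. *)
Lemma hull_tangent_ball (h : R) (Y : pset) (u p q : pt) :
  0 < h -> dot u u = 1 -> hull h Y p -> hull h Y q ->
  (forall z, hull h Y z -> dot u z <= dot u p) ->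
  sqdist q (vsub p (vscal h u)) <= h * h.
Proof.
  intros Hh Hu Kp Kq Hmax.
  apply Rnot_lt_le; intros Hlt.
  set (d := sqdist p q). set (w := dot u (vsub q p)).
  assert (E : sqdist q (vsub p (vscal h u)) = d + 2 * h * w + h * h * dot u u)
    by (unfold d, w; vring).
  rewrite Hu in E.
  assert (Hd : 0 <= d) by apply sqdist_nonneg.
  assert (Hw : 0 < d + 2 * h * w) by lra.
  (* points [seg p q t] pushed by [t(1-t)d/(2h)] in direction [u] stay in every ball *)
  assert (Z : forall t, 0 <= t <= 1 ->
    hull h Y (vadd (seg p q t) (vscal (t * (1 - t) * d / (2 * h)) u))).
  { intros t Ht c Hc. set (k := t * (1 - t) * d / (2 * h)).
    specialize (Kp c Hc); specialize (Kq c Hc).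
    assert (Hk : 2 * h * k = t * (1 - t) * d) by (unfold k; field; lra).
    assert (0 <= t * (1 - t) * d) by (apply Rmult_le_pos; nra).
    assert (Hk0 : 0 <= k) by nra.
    assert (Hm : sqdist (seg p q t) c <= h * h - 2 * h * k).
    { rewrite sqdist_seg, Hk. fold d. nra. }
    assert (Hkh : k <= h).
    { pose proof (sqdist_nonneg (seg p q t) c). nra. }
    assert (Hm2 : sqdist (seg p q t) c <= (h - k) * (h - k)) by nra.
    apply dist_le_iff in Hm2; [|lra].
    assert (Hn : sqdist (vadd (seg p q t) (vscal k u)) (seg p q t) <= k * k).
    { replace (sqdist (vadd (seg p q t) (vscal k u)) (seg p q t)) with (k * k * dot u u) by vring.
      rewrite Hu; lra. }
    apply dist_le_iff in Hn; [|lra].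
    apply dist_le_iff; [lra|].
    pose proof (dist_triangle (vadd (seg p q t) (vscal k u)) (seg p q t) c). lra. }
  assert (V : forall t, 0 <= t <= 1 -> t * (w + (1 - t) * d / (2 * h)) <= 0).
  { intros t Ht. specialize (Hmax _ (Z t Ht)).
    replace (dot u (vadd (seg p q t) (vscal (t * (1 - t) * d / (2 * h)) u)))
      with (dot u p + t * w + t * (1 - t) * d / (2 * h) * dot u u) in Hmax
      by (generalize (t * (1 - t) * d / (2 * h)); unfold w, seg; clear; vring).
    rewrite Hu in Hmax. unfold Rdiv in *. nra. }
  destruct (Req_dec d 0) as [D0|D0].
  - specialize (V 1 ltac:(lra)). rewrite D0 in *. assert (0 < w) by nra.
    replace (1 * (w + (1 - 1) * 0 / (2 * h))) with w in V by (field; lra). lra.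
  - assert (0 < d) by lra.
    (* Half the positive zero of the height [t (w + (1 - t) d / (2 h))]. If it exceeds 1, then
       [2 h w > d] and [q] itself lies above the plane. *)
    set (t := (d + 2 * h * w) / (2 * d)).
    assert (Ht0 : 0 < t) by (apply Rdiv_lt_0_compat; lra).
    destruct (Rle_lt_dec t 1) as [Ht1|Ht1].
    + specialize (V t ltac:(lra)).
      replace (w + (1 - t) * d / (2 * h)) with ((d + 2 * h * w) / (4 * h)) in V
        by (unfold t; field; lra).
      assert (0 < (d + 2 * h * w) / (4 * h)) by (apply Rdiv_lt_0_compat; lra). nra.
    + specialize (V 1 ltac:(lra)).
      replace (1 * (w + (1 - 1) * d / (2 * h))) with w in V by (field; lra).
      assert (2 * d < d + 2 * h * w).
      { unfold t in Ht1. apply (Rmult_lt_compat_r (2 * d)) in Ht1; [|lra].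
        unfold Rdiv in Ht1. rewrite Rmult_assoc, Rinv_l in Ht1; lra. }
      nra.
Qed.

Lemma vnorm_one (u : pt) : vnorm u = 1 -> dot u u = 1.
Proof.
  intros H. pose proof (sqrt_sqrt (dot u u) (dot_self_nonneg u)) as E.
  fold (vnorm u) in E. rewrite H in E. lra.
Qed.

(** The diameter bounds the width from above. For the lower bound, the point at depth [h] under the
    contact point [p1] belongs to the hull: each centre is itself a point of the hull, so by
    [hull_tangent_ball] it lies within [h] of that point. *)
Lemma complete_constant_width (h : R) (Y : pset) : 0 < h ->
  (forall c, Y c -> hull h Y c) ->
  (forall p q, hull h Y p -> hull h Y q -> sqdist p q <= h * h) ->
  constant_width (hull h Y) h.
Proof.
  intros Hh HY Hdiam u c1 c2 Hu [M1 [p1 [K1 E1]]] [M2 [p2 [K2 E2]]].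
  apply vnorm_one in Hu.
  assert (Hop : forall p, dot (vopp u) p = - dot u p) by vring.
  rewrite Hop in E2.
  apply Rle_antisym.
  - replace (c1 - c2) with (dot u (vsub p1 p2)).
    2:{ replace (dot u (vsub p1 p2)) with (dot u p1 - dot u p2) by vring. lra. }
    pose proof (cauchy_schwarz u (vsub p1 p2)) as CS. fold (sqdist p1 p2) in CS.
    specialize (Hdiam p1 p2 K1 K2). rewrite Hu in CS. nra.
  - assert (K : hull h Y (vsub p1 (vscal h u))).
    { intros c Yc. rewrite sqdist_sym. apply (hull_tangent_ball h Y u p1 c); auto.
      intros z Kz; rewrite E1; auto. }
    specialize (M2 _ K). rewrite Hop in M2.
    replace (dot u (vsub p1 (vscal h u))) with (dot u p1 - h * dot u u) in M2 by vring.
    rewrite Hu in M2. lra.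
Qed.

(** * Paths and arcs *)

(** [T] is the supremum of the times up to [t1] at which [P] holds; the first hypothesis makes [P]
    closed, so [P T] holds. Nothing is claimed about the times before [T]. *)
Lemma last_exit (P : R -> Prop) (t1 : R) :
  (forall t, ~ P t -> exists d, 0 < d /\ forall s, Rabs (s - t) < d -> ~ P s) ->
  0 <= t1 -> P 0 -> ~ P t1 ->
  exists T, 0 <= T < t1 /\ P T /\ forall d, 0 < d -> exists s, T < s < T + d /\ ~ P s.
Proof.
  intros Hcl Ht1 P0 Pn.
  destruct (completeness (fun t => 0 <= t <= t1 /\ P t)) as [T [Hub Hlub]].
  { exists t1; intros t [? _]; lra. } { exists 0; split; [lra|auto]. }
  assert (HT0 : 0 <= T) by (apply Hub; split; [lra|auto]).
  assert (HT1 : T <= t1) by (apply Hlub; intros t [? _]; lra).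
  assert (PT : P T).
  { apply NNPP; intros Hn. destruct (Hcl T Hn) as [d [Hd H]].
    assert (T <= T - d); [|lra]. apply Hlub. intros t [Ht Pt].
    assert (t <= T) by (apply Hub; auto).
    apply Rnot_lt_le; intros Hlt. apply (H t); auto. apply Rabs_def1; lra. }
  assert (T <> t1) by (intros ->; auto).
  exists T; split; [lra|]; split; auto.
  intros d Hd. exists (T + Rmin (d / 2) (t1 - T)).
  assert (0 < Rmin (d / 2) (t1 - T)) by (apply Rmin_pos; lra).
  pose proof (Rmin_l (d / 2) (t1 - T)); pose proof (Rmin_r (d / 2) (t1 - T)).
  split; [lra|]. intros Ps.
  assert (T + Rmin (d / 2) (t1 - T) <= T) by (apply Hub; split; [lra|auto]). lra.
Qed.

(** Retraction of the line onto [[u, v]]. Composed with it, a function continuous on the interval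
    becomes continuous everywhere, as [IVT_cor] demands. *)
Definition clamp (u v t : R) : R := Rmax u (Rmin v t).

Lemma clamp_in (u v t : R) : u <= v -> u <= clamp u v t <= v.
Proof. intros; unfold clamp, Rmax, Rmin; repeat destruct Rle_dec; lra. Qed.

Lemma clamp_id (u v t : R) : u <= t <= v -> clamp u v t = t.
Proof. intros; unfold clamp, Rmax, Rmin; repeat destruct Rle_dec; lra. Qed.

Lemma clamp_lip (u v s t : R) : u <= v -> Rabs (clamp u v s - clamp u v t) <= Rabs (s - t).
Proof.
  intros; unfold clamp, Rmax, Rmin, Rabs; repeat destruct Rle_dec;
    repeat destruct Rcase_abs; lra.
Qed.

Lemma clamp_continuity (f : R -> R) (u v : R) : u <= v ->
  (forall t, u <= t <= v -> forall e, 0 < e -> exists d, 0 < d /\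
     forall s, u <= s <= v -> Rabs (s - t) < d -> Rabs (f s - f t) < e) ->
  continuity (fun t => f (clamp u v t)).
Proof.
  intros Huv Hf t. intros e He.
  destruct (Hf (clamp u v t) (clamp_in u v t Huv) e He) as [d [Hd H]].
  exists d; split; auto. intros s [_ Hs]. simpl in *. unfold R_dist in *.
  apply H; [now apply clamp_in|].
  eapply Rle_lt_trans; [now apply clamp_lip|auto].
Qed.

Lemma ivt_on (f : R -> R) (u v : R) : u <= v ->
  (forall t, u <= t <= v -> forall e, 0 < e -> exists d, 0 < d /\
     forall s, u <= s <= v -> Rabs (s - t) < d -> Rabs (f s - f t) < e) ->
  f u * f v <= 0 -> exists t, u <= t <= v /\ f t = 0.
Proof.
  intros Huv Hf Hs.
  destruct (IVT_cor (fun t => f (clamp u v t)) u v) as [t [Ht E]].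
  - now apply clamp_continuity. - auto.
  - now rewrite !clamp_id by lra.
  - exists t; split; auto. now rewrite clamp_id in E.
Qed.

(** Connectedness of an interval: a locally constant [P] has a continuous indicator with values 1
    and -1, which cannot change sign. *)
Lemma clopen_interval (P : R -> Prop) (u v : R) : u <= v ->
  (forall t, u <= t <= v -> exists d, 0 < d /\
     forall s, u <= s <= v -> Rabs (s - t) < d -> (P s <-> P t)) ->
  P u -> P v.
Proof.
  intros Huv Hl Pu. apply NNPP; intros Pv.
  set (f := fun t => if excluded_middle_informative (P t) then 1 else -1).
  destruct (ivt_on f u v Huv) as [t [Ht E]].
  - intros t Ht e He. destruct (Hl t Ht) as [d [Hd H]]. exists d; split; auto.
    intros s Hs Hst. unfold f.
    destruct (excluded_middle_informative (P s)), (excluded_middle_informative (P t));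
      try (exfalso; specialize (H s Hs Hst); tauto);
      match goal with |- Rabs ?x < _ => replace x with 0 by lra end; rewrite Rabs_R0; auto.
  - unfold f. destruct (excluded_middle_informative (P u)), (excluded_middle_informative (P v));
      try tauto; lra.
  - unfold f in E. destruct excluded_middle_informative; lra.
Qed.

Lemma dot_dist_bound (n p q : pt) : Rabs (dot n p - dot n q) <= vnorm n * dist p q.
Proof.
  replace (dot n p - dot n q) with (dot n (vsub p q)) by vring.
  pose proof (cauchy_schwarz n (vsub p q)) as CS. fold (sqdist p q) in CS.
  rewrite <- dist_sqdist in CS.
  rewrite <- (sqrt_sqrt (dot n n) (dot_self_nonneg n)) in CS. fold (vnorm n) in CS.
  pose proof (dist_nonneg p q). assert (0 <= vnorm n) by apply sqrt_pos.
  assert (0 <= vnorm n * dist p q) by nra.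
  apply Rabs_le. split; nra.
Qed.

(** Continuity of functions on space is needed only for coordinates, distances and [dihedral_gap],
    all of which are Lipschitz. *)
Definition lipschitz (f : pt -> R) : Prop :=
  exists M, 0 < M /\ forall p q, Rabs (f p - f q) <= M * dist p q.

Lemma lipschitz_dot (n : pt) : lipschitz (dot n).
Proof.
  exists (vnorm n + 1). assert (0 <= vnorm n) by apply sqrt_pos. split; [lra|].
  intros p q. pose proof (dot_dist_bound n p q). pose proof (dist_nonneg p q). nra.
Qed.

Lemma lipschitz_dist (c : pt) : lipschitz (fun p => dist p c).
Proof.
  exists 1; split; [lra|]. intros p q. apply Rabs_le.
  pose proof (dist_triangle p q c); pose proof (dist_triangle q p c).
  rewrite (dist_sym q p) in *. lra.
Qed.

Lemma path_lipschitz_cont (g : R -> pt) (f : pt -> R) : cont_on01 g -> lipschitz f ->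
  forall t, 0 <= t <= 1 -> forall e, 0 < e -> exists d, 0 < d /\
     forall s, 0 <= s <= 1 -> Rabs (s - t) < d -> Rabs (f (g s) - f (g t)) < e.
Proof.
  intros Hg [M [HM Hf]] t Ht e He.
  destruct (Hg t Ht (e / M)) as [d [Hd H]]; [now apply Rdiv_lt_0_compat|].
  exists d; split; auto. intros s Hs Hst. specialize (H s Hs Hst).
  eapply Rle_lt_trans; [apply Hf|].
  apply (Rmult_lt_compat_l M) in H; auto. replace (M * (e / M)) with e in H by (field; lra). auto.
Qed.

Lemma path_ivt (g : R -> pt) (f : pt -> R) (u v : R) : cont_on01 g -> lipschitz f ->
  0 <= u <= v -> v <= 1 -> f (g u) * f (g v) <= 0 ->
  exists t, u <= t <= v /\ f (g t) = 0.
Proof.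
  intros Hg Hf Huv Hv Hs. apply (ivt_on (fun t => f (g t))); auto; [lra|].
  intros t Ht e He.
  destruct (path_lipschitz_cont g f Hg Hf t ltac:(lra) e He) as [d [Hd H]].
  exists d; split; auto. intros s Hst; apply H; lra.
Qed.

Lemma arc_farthest (A : pset) (a b p : pt) : is_arc A a b ->
  exists f, A f /\ forall f', A f' -> sqdist p f' <= sqdist p f.
Proof.
  intros [g [c [n [r [Hg [_ [_ [_ [HA _]]]]]]]]].
  destruct (continuity_ab_maj (fun t => dist (g (clamp 0 1 t)) p) 0 1) as [t [HM Ht]]; [lra| |].
  - intros t _. apply (clamp_continuity (fun t => dist (g t) p)); [lra|].
    apply (path_lipschitz_cont g (fun q => dist q p)); auto. apply lipschitz_dist.
  - exists (g t); split; [apply HA; eauto|].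
    intros f' Hf'. apply HA in Hf' as [s [Hs ->]].
    specialize (HM s Hs); simpl in HM. rewrite !clamp_id in HM by auto.
    rewrite <- !dist_sqdist, !(dist_sym p). pose proof (dist_nonneg (g s) p). nra.
Qed.

Lemma is_arc_rev (A : pset) (p q : pt) : is_arc A p q -> is_arc A q p.
Proof.
  intros [g [c [n [r [Hg [Hinj [H0 [H1 [HA [Hr [Hn Hc]]]]]]]]]]].
  exists (fun t => g (1 - t)), c, n, r. repeat split; auto.
  - intros t Ht e He. destruct (Hg (1 - t) ltac:(lra) e He) as [d [Hd H]].
    exists d; split; auto. intros s Hs Hst. apply H; [lra|].
    replace (1 - s - (1 - t)) with (- (s - t)) by ring. now rewrite Rabs_Ropp.
  - intros s t Hs Ht E. apply Hinj in E; lra.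
  - now rewrite Rminus_0_r.
  - now rewrite Rminus_diag.
  - intros Hz; apply HA in Hz as [t [Ht ->]]. exists (1 - t); split; [lra|]. f_equal; lra.
  - intros [t [Ht ->]]. apply HA. exists (1 - t); split; [lra|auto].
  - apply Hc; lra.
  - apply Hc; lra.
Qed.

(** * Minor arcs in cone form *)

(** At the parameter [m / (l + m)] the chord has the direction of the point seen from [c], and
    normalising restores the length [h]. *)
Lemma minor_arc_intro (h : R) (c u v : pt) (l m : R) :
  0 < h -> 0 <= l -> 0 <= m -> 0 < l + m ->
  sqdist (comb c u v l m) c = h * h -> minor_arc c u v h (comb c u v l m).
Proof.
  intros Hh Hl Hm Hlm Hp.
  exists (m / (l + m)); split.
  { split; [apply Rle_mult_inv_pos; lra|].
    apply Rmult_le_reg_r with (l + m); [lra|]. unfold Rdiv.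
    rewrite Rmult_assoc, Rinv_l; lra. }
  set (w := vadd (vscal (1 - m / (l + m)) (vsub u c)) (vscal (m / (l + m)) (vsub v c))).
  assert (Hw : w = vscal (/ (l + m)) (vsub (comb c u v l m) c)).
  { unfold w. replace (1 - m / (l + m)) with (l * / (l + m)) by (field; lra).
    unfold Rdiv. generalize (/ (l + m)). clear. veq. }
  assert (Hn : vnorm w = h / (l + m)).
  { rewrite Hw. unfold vnorm.
    replace (dot (vscal (/ (l + m)) (vsub (comb c u v l m) c))
                 (vscal (/ (l + m)) (vsub (comb c u v l m) c)))
      with ((/ (l + m)) * (/ (l + m)) * sqdist (comb c u v l m) c)
      by (generalize (/ (l + m)); clear; vring).
    rewrite Hp. replace (/ (l + m) * / (l + m) * (h * h)) with ((h / (l+m)) * (h / (l+m)))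
      by (field; lra).
    apply sqrt_square. apply Rle_mult_inv_pos; lra. }
  unfold normalize. rewrite Hn, Hw.
  assert (E : h * (/ (h / (l + m)) * / (l + m)) = 1) by (field; lra).
  revert E. generalize (/ (h / (l + m))) (/ (l + m)). clear.
  intros r s E.
  transitivity (vadd c (vscal (h * (r * s)) (vsub (comb c u v l m) c))); [rewrite E|]; veq.
Qed.

(** The bound on [sqdist u v] keeps the chord away from [c], its squared distance being at least
    three quarters of [h * h], so the normalisation never divides by zero. *)
Lemma minor_arc_elim (h : R) (c u v p : pt) : 0 < h ->
  sqdist u c = h * h -> sqdist v c = h * h -> sqdist u v <= h * h -> minor_arc c u v h p ->
  sqdist p c = h * h /\ exists l m, 0 <= l /\ 0 <= m /\ 0 < l + m /\ p = comb c u v l m.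
Proof.
  intros Hh Hu Hv Huv [t [Ht ->]].
  set (w := vadd (vscal (1 - t) (vsub u c)) (vscal t (vsub v c))).
  assert (Hw : dot w w = h * h - t * (1 - t) * sqdist u v).
  { unfold w.
  transitivity ((1 - t) * sqdist u c + t * sqdist v c - t * (1 - t) * sqdist u v); [vring|].
    rewrite Hu, Hv; ring. }
  assert (Hw0 : 0 < dot w w).
  { rewrite Hw. pose proof (sqdist_nonneg u v). assert (0 < h * h) by nra.
    assert (0 <= t * (1 - t) <= 1 / 4)
      by (pose proof (Rle_0_sqr (t - 1 / 2)); unfold Rsqr in *; split; nra).
    assert (t * (1 - t) * sqdist u v <= 1 / 4 * (h * h)) by (apply Rmult_le_compat; lra). lra. }
  assert (Hn : 0 < vnorm w) by (apply sqrt_lt_R0; auto).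
  assert (Hnn : vnorm w * vnorm w = dot w w) by (apply sqrt_sqrt; lra).
  split.
  - unfold normalize.
    transitivity ((h * / vnorm w) * (h * / vnorm w) * dot w w).
    { generalize (/ vnorm w); generalize w; clear; vring. }
    rewrite <- Hnn. field. lra.
  - exists (h * / vnorm w * (1 - t)), (h * / vnorm w * t).
    assert (0 < h * / vnorm w) by (apply Rmult_lt_0_compat; [lra|now apply Rinv_0_lt_compat]).
    split; [nra|]; split; [nra|]; split; [nra|].
    unfold normalize. generalize (/ vnorm w); unfold w; clear; veq.
Qed.

Lemma minor_arc_fan (h : R) (c u v q p : pt) : 0 < h ->
  sqdist u c = h * h -> sqdist v c = h * h -> sqdist u v <= h * h -> minor_arc c u v h p ->
  sqdist u q <= h * h -> sqdist v q <= h * h -> sqdist p q <= h * h.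
Proof.
  intros Hh Hu Hv Huv Hp Huq Hvq.
  destruct (minor_arc_elim h c u v p Hh Hu Hv Huv Hp) as [Hpc [l [m [Hl [Hm [_ ->]]]]]].
  apply (fan (h * h)); auto; nra.
Qed.

(** * Orthogonal frames *)

(** The squared determinant is the Gram determinant, here the product of the squared lengths; it is
    nonzero, and Cramer's rule gives [w = 0]. *)
Lemma orthogonal_frame_complete (i j k w : pt) :
  dot i j = 0 -> dot i k = 0 -> dot j k = 0 ->
  dot i i * dot j j * dot k k <> 0 ->
  dot w i = 0 -> dot w j = 0 -> dot w k = 0 -> w = vzero.
Proof.
  intros Hij Hik Hjk Hn Wi Wj Wk. apply dot_self_eq0.
  destruct i as [[i1 i2] i3], j as [[j1 j2] j3], k as [[k1 k2] k3], w as [[w1 w2] w3].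
  set (det := i1 * (j2 * k3 - j3 * k2) - i2 * (j1 * k3 - j3 * k1) + i3 * (j1 * k2 - j2 * k1)).
  unfold dot in *.
  assert (Hdet : det * det = (i1*i1+i2*i2+i3*i3) * (j1*j1+j2*j2+j3*j3) * (k1*k1+k2*k2+k3*k3)).
  { transitivity ((i1*i1+i2*i2+i3*i3) * (j1*j1+j2*j2+j3*j3) * (k1*k1+k2*k2+k3*k3)
      + 2 * (i1*j1+i2*j2+i3*j3) * (i1*k1+i2*k2+i3*k3) * (j1*k1+j2*k2+j3*k3)
      - (i1*i1+i2*i2+i3*i3) * (j1*k1+j2*k2+j3*k3) * (j1*k1+j2*k2+j3*k3)
      - (j1*j1+j2*j2+j3*j3) * (i1*k1+i2*k2+i3*k3) * (i1*k1+i2*k2+i3*k3)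
      - (k1*k1+k2*k2+k3*k3) * (i1*j1+i2*j2+i3*j3) * (i1*j1+i2*j2+i3*j3));
      [unfold det; ring | rewrite Hij, Hik, Hjk; ring]. }
  assert (Hd : det <> 0) by (intros E; apply Hn; rewrite <- Hdet, E; ring).
  assert (E1 : det * w1 = (w1*i1+w2*i2+w3*i3) * (j2*k3-j3*k2) + (w1*j1+w2*j2+w3*j3) * (k2*i3-k3*i2)
     + (w1*k1+w2*k2+w3*k3) * (i2*j3-i3*j2)) by (unfold det; ring).
  assert (E2 : det * w2 = (w1*i1+w2*i2+w3*i3) * (j3*k1-j1*k3) + (w1*j1+w2*j2+w3*j3) * (k3*i1-k1*i3)
     + (w1*k1+w2*k2+w3*k3) * (i3*j1-i1*j3)) by (unfold det; ring).
  assert (E3 : det * w3 = (w1*i1+w2*i2+w3*i3) * (j1*k2-j2*k1) + (w1*j1+w2*j2+w3*j3) * (k1*i2-k2*i1)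
     + (w1*k1+w2*k2+w3*k3) * (i1*j2-i2*j1)) by (unfold det; ring).
  rewrite Wi, Wj, Wk in *.
  assert (w1 = 0) by (apply (Rmult_eq_reg_l det); lra).
  assert (w2 = 0) by (apply (Rmult_eq_reg_l det); lra).
  assert (w3 = 0) by (apply (Rmult_eq_reg_l det); lra).
  subst; ring.
Qed.

Lemma frame_expansion (i j k v : pt) :
  dot i j = 0 -> dot i k = 0 -> dot j k = 0 ->
  dot i i <> 0 -> dot j j <> 0 -> dot k k <> 0 ->
  v = vadd (vscal (dot i v / dot i i) i)
        (vadd (vscal (dot j v / dot j j) j) (vscal (dot k v / dot k k) k)).
Proof.
  intros Hij Hik Hjk Hi Hj Hk. apply vsub_eq0.
  assert (Ei : dot i v / dot i i * dot i i = dot i v) by (field; auto).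
  assert (Ej : dot j v / dot j j * dot j j = dot j v) by (field; auto).
  assert (Ek : dot k v / dot k k * dot k k = dot k v) by (field; auto).
  revert Ei Ej Ek. generalize (dot i v / dot i i) (dot j v / dot j j) (dot k v / dot k k).
  intros l m n Ei Ej Ek.
  apply (orthogonal_frame_complete i j k); auto.
  - transitivity (dot i v - l * dot i i - m * dot i j - n * dot i k);
      [vring | rewrite Ei, Hij, Hik; ring].
  - transitivity (dot j v - l * dot i j - m * dot j j - n * dot j k);
      [vring | rewrite Ej, Hij, Hjk; ring].
  - transitivity (dot k v - l * dot i k - m * dot j k - n * dot k k);
      [vring | rewrite Ek, Hik, Hjk; ring].
Qed.

(** * Coordinates adapted to a pair of dual edges *)

(** A tetrahedron with opposite edges [xy] and [ab] whose four other edges have length [h]. These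
    equal lengths make the lines [xy], [ab] and the line of midpoints pairwise perpendicular, which
    is why the frame below exists. *)
Definition quad (h : R) (x y a b : pt) : Prop :=
  0 < h /\ x <> y /\ a <> b /\ sqdist x y <= h * h /\ sqdist a b <= h * h /\
  sqdist x a = h * h /\ sqdist x b = h * h /\ sqdist y a = h * h /\ sqdist y b = h * h.

Lemma quad_swap (h : R) (x y a b : pt) : quad h x y a b -> quad h x y b a.
Proof. unfold quad; rewrite (sqdist_sym b a); intuition congruence. Qed.

(* Origin at the midpoint of [ab], axes along [xy], [ab] and the line of midpoints, scaled so
   that [x, y = (-1,0,1), (1,0,1)] and [a, b = (0,1,0), (0,-1,0)]. *)
Definition qo (a b : pt) : pt := vscal (1/2) (vadd a b).
Definition qi (x y : pt) : pt := vscal (1/2) (vsub y x).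
Definition qj (a b : pt) : pt := vscal (1/2) (vsub a b).
Definition qk (x y a b : pt) : pt := vsub (vscal (1/2) (vadd x y)) (qo a b).
Definition sqi (x y : pt) : R := dot (qi x y) (qi x y).
Definition sqj (a b : pt) : R := dot (qj a b) (qj a b).
Definition sqk (x y a b : pt) : R := dot (qk x y a b) (qk x y a b).
Definition cA (x y a b p : pt) : R := dot (qi x y) (vsub p (qo a b)) / sqi x y.
Definition cB (x y a b p : pt) : R := dot (qj a b) (vsub p (qo a b)) / sqj a b.
Definition cG (x y a b p : pt) : R := dot (qk x y a b) (vsub p (qo a b)) / sqk x y a b.

(** The circle where the spheres of [a] and [b] meet lies in the plane [B = 0] around the origin; in
    the scaled coordinates it is an ellipse through [x] and [y]. The condition [1 <= G] selects the
    part beyond the chord [xy]. *)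
Definition upper_arc (x y a b e : pt) : Prop :=
  cB x y a b e = 0 /\
  sqi x y * (cA x y a b e * cA x y a b e) + sqk x y a b * (cG x y a b e * cG x y a b e)
    = sqi x y + sqk x y a b /\
  1 <= cG x y a b e.

(** Exchanging [a] and [b] only changes the sign of [B]; arguments on one side of the plane [B = 0]
    carry over to the other by these identities. *)
Lemma qj_swap (a b : pt) : qj b a = vopp (qj a b).
Proof. unfold qj; veq. Qed.
Lemma qo_swap (a b : pt) : qo b a = qo a b.
Proof. unfold qo; veq. Qed.
Lemma qk_swap (x y a b : pt) : qk x y b a = qk x y a b.
Proof. unfold qk; now rewrite qo_swap. Qed.
Lemma sqj_swap (a b : pt) : sqj b a = sqj a b.
Proof. unfold sqj; rewrite qj_swap; generalize (qj a b); vring. Qed.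
Lemma sqk_swap (x y a b : pt) : sqk x y b a = sqk x y a b.
Proof. unfold sqk; now rewrite qk_swap. Qed.
Lemma cA_swap (x y a b p : pt) : cA x y b a p = cA x y a b p.
Proof. unfold cA; now rewrite qo_swap. Qed.
Lemma cB_swap (x y a b p : pt) : cB x y b a p = - cB x y a b p.
Proof.
  unfold cB; rewrite qo_swap, sqj_swap, qj_swap. unfold Rdiv. rewrite Ropp_mult_distr_l.
  f_equal. generalize (qj a b) (qo a b); vring.
Qed.
Lemma cG_swap (x y a b p : pt) : cG x y b a p = cG x y a b p.
Proof. unfold cG; now rewrite qo_swap, qk_swap, sqk_swap. Qed.

Lemma upper_arc_swap (x y a b e : pt) : upper_arc x y a b e -> upper_arc x y b a e.
Proof. unfold upper_arc; rewrite cB_swap, cA_swap, cG_swap, sqk_swap. intuition lra. Qed.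

Section Quad.
Variables (h : R) (x y a b : pt).
Hypothesis Q : quad h x y a b.

Ltac sgen := generalize x y a b; clear; intros u0 v0 u1 v1.

Notation S := (sqi x y).
Notation Rr := (sqj a b).
Notation T := (sqk x y a b).
Notation A := (cA x y a b).
Notation B := (cB x y a b).
Notation G := (cG x y a b).

Lemma quad_radius_pos : 0 < h.
Proof. apply Q. Qed.

Lemma S_eq : S = sqdist x y / 4.
Proof. unfold sqi, qi. sgen; dpt; vunf; field. Qed.
Lemma R_eq : Rr = sqdist a b / 4.
Proof. unfold sqj, qj. sgen; dpt; vunf; field. Qed.
Lemma S_pos : 0 < S.
Proof. rewrite S_eq. pose proof (sqdist_pos x y). destruct Q. intuition lra. Qed.
Lemma R_pos : 0 < Rr.
Proof. rewrite R_eq. pose proof (sqdist_pos a b). destruct Q. intuition lra. Qed.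
Lemma S_le : 4 * S <= h * h.
Proof. rewrite S_eq. destruct Q. intuition lra. Qed.
Lemma R_le : 4 * Rr <= h * h.
Proof. rewrite R_eq. destruct Q. intuition lra. Qed.

(** Pythagoras for [x - a], whose coordinates are (-1, -1, 1). Averaging the four equal lengths
    makes the mixed products cancel, so orthogonality of the frame is not presupposed. *)
Lemma SRT : S + Rr + T = h * h.
Proof.
  destruct Q as [_ [_ [_ [_ [_ [H1 [H2 [H3 H4]]]]]]]].
  transitivity ((sqdist x a + sqdist x b + sqdist y a + sqdist y b) / 4).
  { unfold sqi, sqj, sqk, qi, qj, qk, qo. sgen; dpt; vunf; field. }
  rewrite H1, H2, H3, H4; field.
Qed.

(** The lengths of [xy] and [ab] are at most [h], so [S] and [Rr] are at most a quarter of [h * h]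
    and [T] takes up the rest. *)
Lemma T_ge : h * h <= 2 * T.
Proof. pose proof SRT; pose proof S_le; pose proof R_le; lra. Qed.
Lemma T_pos : 0 < T.
Proof. pose proof T_ge; pose proof quad_radius_pos; nra. Qed.

Lemma ij0 : dot (qi x y) (qj a b) = 0.
Proof.
  destruct Q as [_ [_ [_ [_ [_ [H1 [H2 [H3 H4]]]]]]]].
  transitivity ((sqdist x a - sqdist x b - sqdist y a + sqdist y b) / 8).
  { unfold qi, qj. sgen; dpt; vunf; field. } rewrite H1, H2, H3, H4; field.
Qed.
Lemma ik0 : dot (qi x y) (qk x y a b) = 0.
Proof.
  destruct Q as [_ [_ [_ [_ [_ [H1 [H2 [H3 H4]]]]]]]].
  transitivity ((- sqdist x a - sqdist x b + sqdist y a + sqdist y b) / 8).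
  { unfold qi, qk, qo. sgen; dpt; vunf; field. } rewrite H1, H2, H3, H4; field.
Qed.
Lemma jk0 : dot (qj a b) (qk x y a b) = 0.
Proof.
  destruct Q as [_ [_ [_ [_ [_ [H1 [H2 [H3 H4]]]]]]]].
  transitivity ((- sqdist x a + sqdist x b - sqdist y a + sqdist y b) / 8).
  { unfold qj, qk, qo. sgen; dpt; vunf; field. } rewrite H1, H2, H3, H4; field.
Qed.

Definition of_coords (al be ga : R) : pt :=
  vadd (qo a b) (vadd (vscal al (qi x y)) (vadd (vscal be (qj a b)) (vscal ga (qk x y a b)))).

Lemma coords_of_coords (al be ga : R) :
  A (of_coords al be ga) = al /\ B (of_coords al be ga) = be /\ G (of_coords al be ga) = ga.
Proof.
  pose proof S_pos; pose proof R_pos; pose proof T_pos.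
  pose proof ij0 as Hij; pose proof ik0 as Hik; pose proof jk0 as Hjk.
  unfold cA, cB, cG, of_coords, sqi, sqj, sqk in *.
  revert Hij Hik Hjk H H0 H1. generalize (qi x y) (qj a b) (qk x y a b) (qo a b). clear.
  intros i j k o Hij Hik Hjk HS HR HT.
  split; [|split]; match goal with |- ?u / ?v = ?w => apply (Rmult_eq_reg_r v); [|lra];
      unfold Rdiv; rewrite Rmult_assoc, Rinv_l, Rmult_1_r by lra end.
  - transitivity (al * dot i i + be * dot i j + ga * dot i k); [vring | rewrite Hij, Hik; ring].
  - transitivity (al * dot i j + be * dot j j + ga * dot j k); [vring | rewrite Hij, Hjk; ring].
  - transitivity (al * dot i k + be * dot j k + ga * dot k k); [vring | rewrite Hik, Hjk; ring].
Qed.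

Lemma of_coords_eta (p : pt) : p = of_coords (A p) (B p) (G p).
Proof.
  unfold of_coords, cA, cB, cG, sqi, sqj, sqk.
  rewrite <- frame_expansion; [generalize (qo a b) p; clear; veq| | | | | |];
    auto using ij0, ik0, jk0; apply Rgt_not_eq; [apply S_pos|apply R_pos|apply T_pos].
Qed.

Lemma coords_inj (p q : pt) : A p = A q -> B p = B q -> G p = G q -> p = q.
Proof. intros H1 H2 H3. rewrite (of_coords_eta p), (of_coords_eta q), H1, H2, H3; auto. Qed.

Lemma sqdist_coords (p q : pt) :
  sqdist p q = S * ((A p - A q) * (A p - A q)) + Rr * ((B p - B q) * (B p - B q))
           + T * ((G p - G q) * (G p - G q)).
Proof.
  rewrite (of_coords_eta p) at 1. rewrite (of_coords_eta q) at 1.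
  pose proof ij0 as Hij; pose proof ik0 as Hik; pose proof jk0 as Hjk.
  unfold of_coords, sqi, sqj, sqk in *.
  generalize dependent (qk x y a b); generalize dependent (qj a b); generalize dependent (qi x y).
  generalize (A p) (B p) (G p) (A q) (B q) (G q) (qo a b); clear.
  intros a1 b1 c1 a2 b2 c2 o i j Hij k Hik Hjk.
  transitivity ((a1 - a2) * (a1 - a2) * dot i i + (b1 - b2) * (b1 - b2) * dot j j
   + (c1 - c2) * (c1 - c2) * dot k k + 2 * ((a1 - a2) * (b1 - b2)) * dot i j
   + 2 * ((a1 - a2) * (c1 - c2)) * dot i k + 2 * ((b1 - b2) * (c1 - c2)) * dot j k).
  { vring. } rewrite Hij, Hik, Hjk; ring.
Qed.

Lemma coords_of (p : pt) (al be ga : R) : p = of_coords al be ga -> A p = al /\ B p = be /\ G p =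
    ga.
Proof. intros ->; apply coords_of_coords. Qed.

Lemma coords_x : A x = -1 /\ B x = 0 /\ G x = 1.
Proof. apply coords_of. unfold of_coords, qo, qi, qj, qk, qo. sgen.
dpt; vunf; apply f_equal2; [apply f_equal2|]; field. Qed.
Lemma coords_y : A y = 1 /\ B y = 0 /\ G y = 1.
Proof. apply coords_of. unfold of_coords, qo, qi, qj, qk, qo. sgen.
dpt; vunf; apply f_equal2; [apply f_equal2|]; field. Qed.
Lemma coords_a : A a = 0 /\ B a = 1 /\ G a = 0.
Proof. apply coords_of. unfold of_coords, qo, qi, qj, qk, qo. sgen.
dpt; vunf; apply f_equal2; [apply f_equal2|]; field. Qed.
Lemma coords_b : A b = 0 /\ B b = -1 /\ G b = 0.
Proof. apply coords_of. unfold of_coords, qo, qi, qj, qk, qo. sgen.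
dpt; vunf; apply f_equal2; [apply f_equal2|]; field. Qed.

Lemma coords_comb (c u v : pt) (l m : R) :
  A (comb c u v l m) = A c + l * (A u - A c) + m * (A v - A c) /\
  B (comb c u v l m) = B c + l * (B u - B c) + m * (B v - B c) /\
  G (comb c u v l m) = G c + l * (G u - G c) + m * (G v - G c).
Proof.
  unfold cA, cB, cG, Rdiv.
  generalize (/ S) (/ Rr) (/ T) (qi x y) (qj a b) (qk x y a b) (qo a b). clear.
  intros; split; [|split]; vring.
Qed.

Lemma lipschitz_affine (n o : pt) (s : R) : lipschitz (fun p => dot n (vsub p o) / s).
Proof.
  destruct (lipschitz_dot n) as [M [HM Hf]].
  exists (M * Rabs (/ s) + 1). pose proof (Rabs_pos (/ s)).
  split; [nra|]. intros p q.
  replace (dot n (vsub p o) / s - dot n (vsub q o) / s) with ((dot n p - dot n q) * / s)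
    by (unfold Rdiv; generalize (/ s); clear; vring).
  rewrite Rabs_mult. specialize (Hf p q). pose proof (dist_nonneg p q).
  pose proof (Rabs_pos (dot n p - dot n q)).
  assert (Rabs (dot n p - dot n q) * Rabs (/ s) <= M * dist p q * Rabs (/ s))
    by (apply Rmult_le_compat_r; auto). nra.
Qed.

Lemma lipschitz_A : lipschitz A.
Proof. apply lipschitz_affine. Qed.
Lemma lipschitz_B : lipschitz B.
Proof. apply lipschitz_affine. Qed.
Lemma lipschitz_G : lipschitz G.
Proof. apply lipschitz_affine. Qed.

End Quad.

(** Exchanging the two edges moves the origin to the midpoint of [xy] and reverses the line of
    midpoints. Thus the dual arc can be described in the frame of the original edge. *)
Lemma dual_coords (h : R) (x y a b p : pt) : quad h x y a b ->
  cA a b x y p = - cB x y a b p /\ cB a b x y p = - cA x y a b p /\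
  cG a b x y p = 1 - cG x y a b p /\
  sqi a b = sqj a b /\ sqj x y = sqi x y /\ sqk a b x y = sqk x y a b.
Proof.
  intros Q. pose proof (jk0 h x y a b Q) as Hjk; pose proof (ik0 h x y a b Q) as Hik.
  pose proof (S_pos h x y a b Q); pose proof (R_pos h x y a b Q); pose proof (T_pos h x y a b Q).
  assert (E1 : qi a b = vopp (qj a b)) by (unfold qi, qj; clear; veq).
  assert (E2 : qj x y = vopp (qi x y)) by (unfold qi, qj; clear; veq).
  assert (E3 : qo x y = vadd (qo a b) (qk x y a b)) by (unfold qk, qo; clear; veq).
  assert (E4 : qk a b x y = vopp (qk x y a b)) by (unfold qk, qo; clear; veq).
  assert (F1 : sqi a b = sqj a b) by (unfold sqi, sqj; rewrite E1; generalize (qj a b); clear;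
      vring).
  assert (F2 : sqj x y = sqi x y) by (unfold sqi, sqj; rewrite E2; generalize (qi x y); clear;
      vring).
  assert (F3 : sqk a b x y = sqk x y a b) by (unfold sqk; rewrite E4; generalize (qk x y a b);
      clear; vring).
  unfold cA, cB, cG. rewrite F1, F2, F3, E1, E2, E3, E4. repeat split.
  - replace (dot (vopp (qj a b)) (vsub p (vadd (qo a b) (qk x y a b))))
      with (- dot (qj a b) (vsub p (qo a b)) + dot (qj a b) (qk x y a b)) by (generalize (qj a b)
          (qo a b) (qk x y a b); clear; vring).
    rewrite Hjk; field; lra.
  - replace (dot (vopp (qi x y)) (vsub p (vadd (qo a b) (qk x y a b))))
      with (- dot (qi x y) (vsub p (qo a b)) + dot (qi x y) (qk x y a b)) by (generalize (qi x y)
          (qo a b) (qk x y a b); clear; vring).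
    rewrite Hik; field; lra.
  - replace (dot (vopp (qk x y a b)) (vsub p (vadd (qo a b) (qk x y a b))))
      with (- dot (qk x y a b) (vsub p (qo a b)) + sqk x y a b) by (unfold sqk; generalize (qo a b)
          (qk x y a b); clear; vring).
    field; lra.
Qed.

Lemma arc_dual_coords (h : R) (x y a b f : pt) : quad h x y a b ->
  (upper_arc a b x y f <->
   cA x y a b f = 0 /\
   sqj a b * (cB x y a b f * cB x y a b f)
     + sqk x y a b * ((1 - cG x y a b f) * (1 - cG x y a b f)) = sqj a b + sqk x y a b /\
   1 <= 1 - cG x y a b f).
Proof.
  intros Q. destruct (dual_coords h x y a b f Q) as [E1 [E2 [E3 [E4 [E5 E6]]]]].
  unfold upper_arc. rewrite E1, E2, E3, E4, E6.
  replace (- cB x y a b f * - cB x y a b f) with (cB x y a b f * cB x y a b f) by ring.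
  intuition lra.
Qed.

(** * Arcs, the dihedral angle and balls centred on the dual arc *)

Section Geo.
Variables (h : R) (x y a b : pt).
Hypothesis Q : quad h x y a b.

Notation S := (sqi x y).
Notation Rr := (sqj a b).
Notation T := (sqk x y a b).
Notation A := (cA x y a b).
Notation B := (cB x y a b).
Notation G := (cG x y a b).

Lemma sqdist_a (p : pt) :
  sqdist p a = S * (A p * A p) + Rr * ((B p - 1) * (B p - 1)) + T * (G p * G p).
Proof. rewrite (sqdist_coords h x y a b Q). destruct (coords_a h x y a b Q) as [-> [-> ->]]. ring.
Qed.
Lemma sqdist_b (p : pt) :
  sqdist p b = S * (A p * A p) + Rr * ((B p + 1) * (B p + 1)) + T * (G p * G p).
Proof. rewrite (sqdist_coords h x y a b Q). destruct (coords_b h x y a b Q) as [-> [-> ->]]. ring.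
Qed.
Lemma sqdist_x (p : pt) :
  sqdist p x = S * ((A p + 1) * (A p + 1)) + Rr * (B p * B p) + T * ((G p - 1) * (G p - 1)).
Proof. rewrite (sqdist_coords h x y a b Q). destruct (coords_x h x y a b Q) as [-> [-> ->]]. ring.
Qed.
Ltac pos := pose proof (S_pos h x y a b Q) as HS; pose proof (R_pos h x y a b Q) as HR;
  pose proof (T_pos h x y a b Q) as HT; pose proof (SRT h x y a b Q) as HSRT;
  pose proof (quad_radius_pos h x y a b Q) as Hh.

Lemma upper_arc_x : upper_arc x y a b x.
Proof. unfold upper_arc; destruct (coords_x h x y a b Q) as [-> [-> ->]]; lra. Qed.
Lemma upper_arc_y : upper_arc x y a b y.
Proof. unfold upper_arc; destruct (coords_y h x y a b Q) as [-> [-> ->]]; lra. Qed.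

Lemma upper_arc_sqdist_a (e : pt) : upper_arc x y a b e -> sqdist e a = h * h.
Proof. pos. intros [H1 [H2 H3]]. rewrite sqdist_a, H1. lra. Qed.
Lemma upper_arc_A_range (e : pt) : upper_arc x y a b e -> -1 <= A e <= 1.
Proof. pos. intros [H1 [H2 H3]]. assert (1 <= G e * G e) by nra. assert (A e * A e <= 1) by nra.
split; nra. Qed.

(** The arc is a graph over the coordinate [A]; this reduces statements about paths along it to the
    intermediate value theorem for [A]. *)
Lemma upper_arc_inj (e e' : pt) : upper_arc x y a b e -> upper_arc x y a b e' -> A e = A e' -> e =
    e'.
Proof.
  pos. intros [H1 [H2 H3]] [H1' [H2' H3']] E. apply (coords_inj h x y a b Q); auto; [lra|].
  rewrite E in H2. assert (T * (G e * G e - G e' * G e') = 0) by lra.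
  assert ((G e - G e') * (G e + G e') = 0) by nra. nra.
Qed.

Lemma circle_coords (e : pt) : sqdist e a = h * h -> sqdist e b = h * h ->
  B e = 0 /\ S * (A e * A e) + T * (G e * G e) = S + T.
Proof.
  pos. intros Ha Hb. rewrite sqdist_a in Ha; rewrite sqdist_b in Hb.
  assert (B e = 0) by nra. split; auto. rewrite H in *. lra.
Qed.

(* The lower half of the circle is further than [h] from [x]. *)
Lemma upper_arc_of_circle (e : pt) : sqdist e a = h * h -> sqdist e b = h * h ->
  sqdist e x <= h * h -> -1 <= A e <= 1 -> upper_arc x y a b e.
Proof.
  pos. pose proof (T_ge h x y a b Q) as HT2.
  intros Ha Hb Hx HA. destruct (circle_coords e Ha Hb) as [H1 H2].
  split; auto; split; auto. rewrite sqdist_x, H1 in Hx.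
  assert (HA2 : A e * A e <= 1) by nra.
  assert (HG : 1 <= G e * G e) by nra.
  destruct (Rle_lt_dec 0 (G e)) as [H0|H0]; [nra|].
  assert (G e <= -1) by nra.
  assert (4 <= (G e - 1) * (G e - 1)) by nra. nra.
Qed.

(** What is known of a point common to the faces of [a] and [b] before the shape of the edge is
    established. *)
Definition near_edge (e : pt) : Prop :=
  sqdist e a = h * h /\ sqdist e b = h * h /\ sqdist e x <= h * h /\ sqdist e y <= h * h.

Lemma path_covers_arc (g : R -> pt) (e : pt) : cont_on01 g -> g 0 = x -> g 1 = y ->
  (forall t, 0 <= t <= 1 -> near_edge (g t)) -> upper_arc x y a b e ->
  exists t, 0 <= t <= 1 /\ g t = e.
Proof.
  intros Hg H0 H1 Hn He. pose proof (upper_arc_A_range e He) as HA.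
  destruct (path_ivt g (fun p => A p - A e) 0 1) as [t [Ht E]]; auto; try lra.
  - destruct (lipschitz_A x y a b) as [M [HM HL]]. exists M; split; auto.
    intros p q. replace (A p - A e - (A q - A e)) with (A p - A q) by ring. auto.
  - rewrite H0, H1. destruct (coords_x h x y a b Q) as [-> _], (coords_y h x y a b Q) as [-> _].
  nra.
  - exists t; split; auto. destruct (Hn t Ht) as [Ha [Hb [Hx _]]].
    apply upper_arc_inj; auto; [apply upper_arc_of_circle; auto; lra | lra].
Qed.

(** To leave the slab between the levels of [x] and [y], the path would have to meet one of these
    levels a second time. The only admissible point there is the endpoint itself, against
    injectivity. *)
Lemma path_in_arc (g : R -> pt) : cont_on01 g -> g 0 = x -> g 1 = y ->
  (forall s t, 0 <= s <= 1 -> 0 <= t <= 1 -> g s = g t -> s = t) ->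
  (forall t, 0 <= t <= 1 -> near_edge (g t)) ->
  forall t, 0 <= t <= 1 -> upper_arc x y a b (g t).
Proof.
  intros Hg H0 H1 Hinj Hn t Ht. destruct (Hn t Ht) as [Ha [Hb [Hx _]]].
  destruct (coords_x h x y a b Q) as [Ax _], (coords_y h x y a b Q) as [Ay _].
  assert (HL : forall c, lipschitz (fun p => A p - c)).
  { intros c. destruct (lipschitz_A x y a b) as [M [HM HL]]. exists M; split; auto.
    intros p q. replace (A p - c - (A q - c)) with (A p - A q) by ring. auto. }
  apply upper_arc_of_circle; auto. split; apply Rnot_lt_le; intros Hlt.
  - destruct (path_ivt g (fun p => A p - -1) t 1) as [s [Hs E]]; auto; try lra.
    { rewrite H1, Ay. nra. }
    destruct (Hn s ltac:(lra)) as [Sa [Sb [Sx _]]].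
    assert (g s = g 0).
    { rewrite H0.
    apply upper_arc_inj; [apply upper_arc_of_circle; auto; lra|apply upper_arc_x|lra]. }
    apply Hinj in H; try lra. assert (t = 0) by lra. subst t. rewrite H0 in Hlt. lra.
  - destruct (path_ivt g (fun p => A p - 1) 0 t) as [s [Hs E]]; auto; try lra.
    { rewrite H0, Ax. nra. }
    destruct (Hn s ltac:(lra)) as [Sa [Sb [Sx _]]].
    assert (g s = g 1).
    { rewrite H1.
    apply upper_arc_inj; [apply upper_arc_of_circle; auto; lra|apply upper_arc_y|lra]. }
    apply Hinj in H; try lra. assert (t = 1) by lra. subst t. rewrite H1 in Hlt. lra.
Qed.

(** In the difference of squared distances to two centres the quadratic terms cancel, so it is
    affine along segments. *)
Lemma sqdist_diff_seg (p q z : pt) (t : R) :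
  sqdist (seg p q t) z - sqdist (seg p q t) a = (1 - t) * (sqdist p z - sqdist p a) + t * (sqdist q
      z - sqdist q a).
Proof. rewrite !sqdist_seg; ring. Qed.

Lemma coords_seg (p q : pt) (t : R) :
  A (seg p q t) = (1 - t) * A p + t * A q /\
  B (seg p q t) = (1 - t) * B p + t * B q /\
  G (seg p q t) = (1 - t) * G p + t * G q.
Proof.
  replace (seg p q t) with (comb p p q 0 t) by (generalize p q; clear; veq).
  destruct (coords_comb x y a b p p q 0 t) as [-> [-> ->]]. repeat split; ring.
Qed.

(* The central projection [p0] of [p] from [a] to the plane of the arc lies in the convex hull of
   the arc, and [p = a + K (p0 - a)] with [K >= 1]. *)
Lemma dihedral_half (p z : pt) :
  - B p <= G p - 1 -> B p <= 0 -> sqdist p a <= h * h ->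
  sqdist a z <= h * h -> (forall e, upper_arc x y a b e -> sqdist e z <= h * h) ->
  sqdist p z <= h * h /\ (sqdist p z = h * h -> z <> a -> sqdist p a = h * h /\ B p = 0).
Proof.
  pos. intros HD HB Hpa Haz HE.
  (* Seen from [a], at level [B = 1], the point [p] is [K] times as far as its projection to the
     plane [B = 0]. *)
  set (K := 1 - B p). assert (HK : 1 <= K) by (unfold K; lra).
  set (al := A p / K). set (ga := G p / K).
  assert (EA : K * al = A p) by (unfold al; field; lra).
  assert (EG : K * ga = G p) by (unfold ga; field; lra).
  assert (Hga : 1 <= ga) by (unfold K in *; nra).
  rewrite sqdist_a in Hpa. replace (B p - 1) with (- K) in Hpa by (unfold K; ring).
  rewrite <- EA, <- EG in Hpa.
  assert (HK2 : 1 <= K * K) by nra.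
  assert (Hseg : S * (al * al) + T * (ga * ga) <= S + T).
  { assert (K * K * (S * (al * al) + Rr + T * (ga * ga)) <= h * h) by lra.
    assert (0 <= S * (al * al) + Rr + T * (ga * ga)).
    { assert (0 <= al * al) by nra. assert (0 <= ga * ga) by nra. nra. }
    set (W := S * (al * al) + Rr + T * (ga * ga)) in *.
    assert (W <= K * K * W) by nra. unfold W in *; lra. }
  assert (Hga2 : 1 <= ga * ga) by nra.
  assert (Hal : al * al <= 1) by nra.
  assert (Hal' : -1 <= al <= 1) by nra.
  set (ge2 := (S + T - S * (al * al)) / T).
  assert (Hge2 : T * ge2 = S + T - S * (al * al)) by (unfold ge2; field; lra).
  set (ge := sqrt ge2).
  assert (Hgg : ga * ga <= ge2) by nra.
  assert (Hge : ge * ge = ge2) by (apply sqrt_sqrt; nra).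
  assert (Hge0 : 0 <= ge) by apply sqrt_pos.
  assert (Hgle : ga <= ge) by nra.
  set (e := of_coords x y a b al 0 ge).
  destruct (coords_of_coords h x y a b Q al 0 ge) as [eA [eB eG]]. fold e in eA, eB, eG.
  assert (He : upper_arc x y a b e) by (unfold upper_arc; rewrite eA, eB, eG, Hge, Hge2; lra).
  (* [w] places [p0] between the chord at height 1 and the arc at height [ge]. If [ge = 1], then
     [ga = 1] as well and any weight serves. *)
  set (w := if Req_EM_T ge 1 then 0 else (ga - 1) / (ge - 1)).
  assert (Hw : 0 <= w <= 1 /\ (1 - w) * 1 + w * ge = ga).
  { unfold w; destruct (Req_EM_T ge 1); [split; lra|].
    split; [|field; lra]. split.
    - apply Rle_mult_inv_pos; lra.
    - apply Rmult_le_reg_r with (ge - 1); [lra|]. unfold Rdiv.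
      rewrite Rmult_assoc, Rinv_l; lra. }
  destruct Hw as [Hw Ew].
  set (p0 := seg (seg x y ((1 + al) / 2)) e w).
  assert (Hp : p = comb a p0 a K 0).
  { apply (coords_inj h x y a b Q);
    destruct (coords_comb x y a b a p0 a K 0) as [cA' [cB' cG']];
    rewrite ?cA', ?cB', ?cG'; unfold p0;
    destruct (coords_seg (seg x y ((1 + al) / 2)) e w) as [sA [sB sG]];
    rewrite ?sA, ?sB, ?sG;
    destruct (coords_seg x y ((1 + al) / 2)) as [tA [tB tG]];
    rewrite ?tA, ?tB, ?tG, ?eA, ?eB, ?eG;
    destruct (coords_a h x y a b Q) as [aA [aB aG]], (coords_x h x y a b Q) as [xA [xB xG]],
      (coords_y h x y a b Q) as [yA [yB yG]];
    rewrite ?aA, ?aB, ?aG, ?xA, ?xB, ?xG, ?yA, ?yB, ?yG.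
    - rewrite <- EA. field.
    - unfold K. field.
    - rewrite <- EG, <- Ew. field. }
  assert (Hf : sqdist p0 z - sqdist p0 a <= 0).
  { unfold p0. rewrite !sqdist_diff_seg.
    rewrite (upper_arc_sqdist_a e He), (upper_arc_sqdist_a x upper_arc_x), (upper_arc_sqdist_a y
        upper_arc_y).
    pose proof (HE e He); pose proof (HE x upper_arc_x); pose proof (HE y upper_arc_y).
    assert (0 <= (1 + al) / 2 <= 1) by lra.
    assert ((1 - (1 + al) / 2) * (sqdist x z - h * h) + (1 + al) / 2 * (sqdist y z - h * h) <= 0)
        by nra.
    nra. }
  assert (Hpz : sqdist p z = sqdist p a + K * (sqdist p0 z - sqdist p0 a) + (1 - K) * sqdist a z).
  { rewrite Hp, sqdist_comb, sqdist_refl. ring. }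
  assert (Hpa' : sqdist p a <= h * h).
  { rewrite sqdist_a, <- EA, <- EG. replace (B p - 1) with (- K) by (unfold K; ring). lra. }
  pose proof (sqdist_nonneg a z) as Haz0.
  assert (K * (sqdist p0 z - sqdist p0 a) <= 0) by nra.
  assert ((1 - K) * sqdist a z <= 0) by nra.
  (* Equality makes both nonpositive terms vanish; as [z] differs from [a], this means [K = 1], that
     is [B p = 0]. *)
  split; [lra|]. intros Heq Hza.
  assert (0 < sqdist a z) by (apply sqdist_pos; auto).
  split; [lra|]. unfold K in *. nra.
Qed.

(** The plane [G = 1 - B] is the one through [a], [x] and [y]. The sphere equation bounds [A p] by 1
    in absolute value and hence by [K], so the cone coefficients are nonnegative. *)
Lemma minor_arc_of_plane (p : pt) : sqdist p a = h * h -> B p <= 0 -> G p = 1 - B p -> minor_arc a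
    x y h p.
Proof.
  pos. intros Hpa HB HG. rewrite sqdist_a, HG in Hpa.
  set (K := 1 - B p) in *. assert (HK : 1 <= K) by (unfold K; lra).
  replace (B p - 1) with (- K) in Hpa by (unfold K; ring).
  assert (HK2 : 1 <= K * K) by nra.
  assert (Rr * (K * K) >= Rr) by nra. assert (T * (K * K) >= T) by nra.
  assert (A p * A p <= 1) by nra. assert (-1 <= A p <= 1) by nra.
  assert (E : p = comb a x y ((K - A p) / 2) ((K + A p) / 2)).
  { apply (coords_inj h x y a b Q);
    destruct (coords_comb x y a b a x y ((K - A p) / 2) ((K + A p) / 2)) as [cA' [cB' cG']];
    rewrite ?cA', ?cB', ?cG';
    destruct (coords_a h x y a b Q) as [aA [aB aG]], (coords_x h x y a b Q) as [xA [xB xG]],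
      (coords_y h x y a b Q) as [yA [yB yG]];
    rewrite ?aA, ?aB, ?aG, ?xA, ?xB, ?xG, ?yA, ?yB, ?yG.
    - field. - unfold K; field. - rewrite HG; field. }
  rewrite E. apply minor_arc_intro; try lra. rewrite <- E, sqdist_a, HG.
  replace (B p - 1) with (- K) by (unfold K; ring). lra.
Qed.

Lemma minor_arc_coords (p : pt) : minor_arc a x y h p -> G p = 1 - B p.
Proof.
  intros Hp. destruct Q as [Hh [_ [_ [Hxy [_ [H1 [_ [H3 _]]]]]]]].
  destruct (minor_arc_elim h a x y p) as [_ [l [m [_ [_ [_ ->]]]]]]; auto.
  destruct (coords_comb x y a b a x y l m) as [_ [-> ->]].
  destruct (coords_a h x y a b Q) as [aA [aB aG]], (coords_x h x y a b Q) as [xA [xB xG]],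
      (coords_y h x y a b Q) as [yA [yB yG]]. 
  rewrite ?aA, ?aB, ?aG, ?xA, ?xB, ?xG, ?yA, ?yB, ?yG. ring.
Qed.

(** The quadratic part in [f] is constant along the dual arc, so the distance depends on [f] only
    through a term linear in [B f] and [1 - G f]. *)
Lemma sqdist_dual_arc (f p : pt) : upper_arc a b x y f ->
  sqdist p f - h * h = S * (A p * A p) + Rr * (B p * B p) + T * ((G p - 1) * (G p - 1)) - S
    - 2 * (Rr * B p * B f - T * (G p - 1) * (1 - G f)).
Proof.
  pos. intros Hf. apply (arc_dual_coords h x y a b f Q) in Hf as [H1 [H2 H3]].
  rewrite (sqdist_coords h x y a b Q), H1. rewrite <- HSRT.
  assert (E : Rr * (B f * B f) = Rr + T - T * ((1 - G f) * (1 - G f))) by lra.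
  replace (Rr * ((B p - B f) * (B p - B f)))
    with (Rr * (B p * B p) - 2 * (Rr * B p * B f) + Rr * (B f * B f)) by ring.
  rewrite E. ring.
Qed.

Lemma dual_arc_a : upper_arc a b x y a.
Proof.
  apply (arc_dual_coords h x y a b a Q). destruct (coords_a h x y a b Q) as [-> [-> ->]]. lra.
Qed.
Lemma dual_arc_b : upper_arc a b x y b.
Proof.
  apply (arc_dual_coords h x y a b b Q). destruct (coords_b h x y a b Q) as [-> [-> ->]]. lra.
Qed.

Lemma dual_arc_range (f : pt) : upper_arc a b x y f ->
  -1 <= B f <= 1 /\ 1 <= 1 - G f /\
  T * ((1 - G f) * (1 - G f) - 1) = Rr * (1 - B f * B f).
Proof.
  pos. intros Hf. apply (arc_dual_coords h x y a b f Q) in Hf as [H1 [H2 H3]].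
  assert (1 <= (1 - G f) * (1 - G f)) by nra. assert (B f * B f <= 1) by nra.
  repeat split; nra.
Qed.

(* [(u, -V)] is on the ellipse [R0 u^2 + T0 V^2 = R0 + T0] through the corners [(1,-1)], [(-1,-1)]. *)
Lemma ellipse_core (R0 T0 be c u V : R) : 0 < R0 -> 0 < T0 ->
  -1 < u < 1 -> 1 < V -> T0 * (V * V - 1) = R0 * (1 - u * u) ->
  R0 * (Rabs be + be * u) <= T0 * c * (V - 1) ->
  Rabs be * (V + 1) <= c * (1 + Rabs u).
Proof.
  intros HR HT Hu HV E H.
  assert (Hau : Rabs u < 1) by (apply Rabs_def1; lra).
  assert (Huu : u * u = Rabs u * Rabs u) by (rewrite <- Rabs_mult; symmetry; apply Rabs_right; nra).
  rewrite Huu in E.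
  assert (Hbu : - (Rabs be * Rabs u) <= be * u).
  { rewrite <- Rabs_mult. pose proof (Rle_abs (- (be * u))). rewrite Rabs_Ropp in *. lra. }
  pose proof (Rabs_pos be); pose proof (Rabs_pos u).
  assert (I1 : R0 * (Rabs be * (1 - Rabs u)) <= T0 * c * (V - 1)) by nra.
  (* The ellipse equation with both differences of squares factored; it trades the factor [V - 1]
     for [1 - Rabs u]. *)
  assert (I2 : T0 * (V - 1) * (V + 1) = R0 * (1 - Rabs u) * (1 + Rabs u)) by nra.
  apply Rmult_le_reg_l with (R0 * (1 - Rabs u)); [apply Rmult_lt_0_compat; lra|].
  apply Rle_trans with (T0 * c * (V - 1) * (V + 1)); [nra|].
  right. transitivity (c * (T0 * (V - 1) * (V + 1))); [ring|]. rewrite I2; ring.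
Qed.

(** The ends [a] and [b] of the dual arc are the corners of the ellipse. By linearity each
    comparison with an end is a linear inequality, and the two combine into one with
    [Rabs (B p)]. *)
Lemma corner_bound (f p : pt) : upper_arc a b x y f -> sqdist p a <= sqdist p f -> sqdist p b <=
    sqdist p f ->
  Rr * (Rabs (B p) + B p * B f) <= T * (G p - 1) * ((1 - G f) - 1).
Proof.
  pos. intros Hf Ha Hb.
  pose proof (sqdist_dual_arc f p Hf) as E. pose proof (sqdist_dual_arc a p dual_arc_a) as Ea.
  pose proof (sqdist_dual_arc b p dual_arc_b) as Eb.
  destruct (coords_a h x y a b Q) as [aA [aB aG]], (coords_b h x y a b Q) as [bA [bB bG]].
  rewrite aB, aG in Ea. rewrite bB, bG in Eb.
  unfold Rabs; destruct Rcase_abs; nra.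
Qed.

(** Such an [f] is not an end of the arc, so [1 - G f > 1] and [Rabs (B f) < 1]. Then [ellipse_core]
    bounds [Rabs (B p)] by [G p - 1] times a ratio smaller than 1. *)
Lemma outside_dual_ball_dihedral (f p : pt) : upper_arc a b x y f -> sqdist p a <= h * h -> sqdist
    p b <= h * h ->
  h * h < sqdist p f -> Rabs (B p) < G p - 1.
Proof.
  pos. intros Hf Ha Hb Hlt. pose proof (dual_arc_range f Hf) as [HB [HV HE]].
  assert (HV1 : 1 < 1 - G f).
  { destruct (Rle_lt_or_eq_dec _ _ HV) as [|HV']; auto. exfalso.
    rewrite <- HV' in HE. assert (HB1 : B f * B f = 1) by nra.
    pose proof (sqdist_dual_arc f p Hf) as E. pose proof (sqdist_dual_arc a p dual_arc_a) as Ea.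
    pose proof (sqdist_dual_arc b p dual_arc_b) as Eb.
    destruct (coords_a h x y a b Q) as [aA [aB aG]], (coords_b h x y a b Q) as [bA [bB bG]].
    rewrite aB, aG in Ea. rewrite bB, bG in Eb. rewrite <- HV' in E.
    assert (B f = 1 \/ B f = -1) as [Hf1|Hf1] by (assert ((B f - 1) * (B f + 1) = 0) as M by lra;
       apply Rmult_integral in M as [|]; [left|right]; lra);
    rewrite Hf1 in E; lra. }
  assert (HB1 : -1 < B f < 1).
  { assert (B f * B f < 1) by nra. split; nra. }
  pose proof (corner_bound f p Hf ltac:(lra) ltac:(lra)) as Hc.
  pose proof (ellipse_core Rr T (B p) (G p - 1) (B f) (1 - G f) HR HT HB1 HV1 HE Hc) as H.
  assert (Hau : Rabs (B f) < 1) by (apply Rabs_def1; lra).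
  pose proof (Rabs_pos (B p)); pose proof (Rabs_pos (B f)).
  (* For [B p = 0] the ratio gives no strictness. If also [G p = 1], the linear term vanishes and
     [p] is as far from [f] as from [a]. *)
  destruct (Req_dec (B p) 0) as [Z|NZ].
  - rewrite Z, Rabs_R0 in *. assert (0 <= G p - 1) by nra.
    destruct (Req_dec (G p - 1) 0) as [Z2|]; [|lra]. exfalso.
    pose proof (sqdist_dual_arc f p Hf) as E. pose proof (sqdist_dual_arc a p dual_arc_a) as Ea.
    rewrite Z, Z2 in *. lra.
  - assert (0 < Rabs (B p)) by (apply Rabs_pos_lt; auto). nra.
Qed.

(* The point of the dual arc in the direction [(- B p, - (G p - 1))], the maximiser in the
   Cauchy-Schwarz inequality *)
Lemma farthest_dual (p : pt) : Rabs (B p) < G p - 1 ->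
  exists f r, upper_arc a b x y f /\ 0 < r /\
    r * r = (Rr + T) * (Rr * (B p * B p) + T * ((G p - 1) * (G p - 1))) /\
    sqdist p f - h * h = S * (A p * A p) + Rr * (B p * B p) + T * ((G p - 1) * (G p - 1)) - S
      + 2 * r.
Proof.
  pos. intros HD. set (c := G p - 1) in *. pose proof (Rabs_pos (B p)).
  set (n := Rr * (B p * B p) + T * (c * c)).
  assert (Hb2 : B p * B p < c * c).
  { replace (B p * B p) with (Rabs (B p) * Rabs (B p))
      by (rewrite <- Rabs_mult; apply Rabs_right; nra). nra. }
  assert (Hb0 : 0 <= B p * B p) by nra.
  assert (Hn : 0 < n) by (unfold n; nra).
  set (l := sqrt ((Rr + T) / n)).
  assert (Hl2 : l * l = (Rr + T) / n)
    by (apply sqrt_sqrt, Rlt_le, Rdiv_lt_0_compat; lra).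
  assert (Hl : 0 < l) by (apply sqrt_lt_R0, Rdiv_lt_0_compat; lra).
  assert (Hln : l * l * n = Rr + T) by (rewrite Hl2; field; lra).
  set (f := of_coords x y a b 0 (- l * B p) (1 - l * c)).
  destruct (coords_of_coords h x y a b Q 0 (- l * B p) (1 - l * c)) as [fA [fB fG]].
  fold f in fA, fB, fG.
  (* [l] scales the direction onto the ellipse. Inside the dihedral angle [n <= c * c * (Rr + T)],
     so the maximiser falls between the corners, on the arc itself. *)
  assert (Hlc : 1 <= l * c).
  { assert (Rr + T <= l * l * (c * c) * (Rr + T)).
    { rewrite <- Hln at 1. assert (n <= c * c * (Rr + T)) by (unfold n; nra).
      assert (0 < l * l) by nra. nra. }
    assert (1 <= l * l * (c * c)) by (apply Rmult_le_reg_r with (Rr + T); lra).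
    assert (0 < l * c) by nra. nra. }
  assert (Hf : upper_arc a b x y f).
  { apply (arc_dual_coords h x y a b f Q). rewrite fA, fB, fG. split; auto. split; [|lra].
    rewrite <- Hln. unfold n. ring. }
  exists f, (l * n). split; auto. split; [nra|]. split.
  - fold n. rewrite <- Hln. ring.
  - rewrite (sqdist_dual_arc f p Hf), fB, fG. fold c. unfold n. ring.
Qed.

(** Lagrange's identity writes [r * r] as the square of the linear term at an end of the arc plus a
    square that is positive strictly inside the angle; so the maximum [r] exceeds the values at both
    ends. *)
Lemma dihedral_farther_from_dual (p : pt) : Rabs (B p) < G p - 1 ->
  exists f, upper_arc a b x y f /\ sqdist p a < sqdist p f /\ sqdist p b < sqdist p f.
Proof.
  pos. intros HD. destruct (farthest_dual p HD) as [f [r [Hf [Hr [Hr2 Hpf]]]]].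
  pose proof (sqdist_dual_arc a p dual_arc_a) as Ea.
  pose proof (sqdist_dual_arc b p dual_arc_b) as Eb.
  destruct (coords_a h x y a b Q) as [aA [aB aG]], (coords_b h x y a b Q) as [bA [bB bG]].
  rewrite aB, aG in Ea. rewrite bB, bG in Eb.
  set (c := G p - 1) in *. pose proof (Rle_abs (B p)). pose proof (Rle_abs (- B p)).
  rewrite Rabs_Ropp in *.
  assert (HRT : 0 < Rr * T) by nra.
  exists f; split; auto.
  assert (F1 : r * r = (Rr * B p - T * c) * (Rr * B p - T * c) + Rr * T * ((B p + c) * (B p + c)))
    by (rewrite Hr2; ring).
  assert (F2 : r * r = (Rr * B p + T * c) * (Rr * B p + T * c) + Rr * T * ((B p - c) * (B p - c)))
    by (rewrite Hr2; ring).
  assert (0 < Rr * T * ((B p + c) * (B p + c))) by (apply Rmult_lt_0_compat; nra).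
  assert (0 < Rr * T * ((B p - c) * (B p - c))) by (apply Rmult_lt_0_compat; nra).
  split; nra.
Qed.

(** Touching at [f] while lying in all the balls makes [f] a farthest point of the dual arc.
    Equality in Cauchy-Schwarz then puts [p] in the plane through [f], [x] and [y], across the line
    [xy] from [f] or on it. *)
Lemma dual_contact_minor_arc (f p : pt) : upper_arc a b x y f -> f <> a -> f <> b -> sqdist p f = h
    * h ->
  (forall f', upper_arc a b x y f' -> sqdist p f' <= h * h) -> minor_arc f x y h p.
Proof.
  pos. intros Hf Hfa Hfb Hpf Hall. pose proof (dual_arc_range f Hf) as [HB [HV HE]].
  pose proof Hf as Hf'. apply (arc_dual_coords h x y a b f Q) in Hf' as [fA [fE _]].
  destruct (coords_a h x y a b Q) as [aA [aB aG]], (coords_b h x y a b Q) as [bA [bB bG]].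
  assert (HV1 : 1 < 1 - G f).
  { destruct (Rle_lt_or_eq_dec _ _ HV) as [|HV']; auto. exfalso.
    rewrite <- HV' in HE.
    assert (B f = 1 \/ B f = -1) as [Hf1|Hf1] by (assert ((B f - 1) * (B f + 1) = 0) as M by nra;
       apply Rmult_integral in M as [|]; [left|right]; lra);
    [apply Hfa | apply Hfb]; apply (coords_inj h x y a b Q); lra. }
  assert (HB1 : -1 < B f < 1).
  { assert (B f * B f < 1) by nra. split; nra. }
  pose proof (Hall a dual_arc_a) as Ha. pose proof (Hall b dual_arc_b) as Hb.
  pose proof (corner_bound f p Hf ltac:(lra) ltac:(lra)) as Hc.
  pose proof (ellipse_core Rr T (B p) (G p - 1) (B f) (1 - G f) HR HT HB1 HV1 HE Hc) as H.
  assert (Hau : Rabs (B f) < 1) by (apply Rabs_def1; lra).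
  pose proof (Rabs_pos (B p)); pose proof (Rabs_pos (B f)).
  set (c := G p - 1) in *. set (V := 1 - G f) in *.
  assert (Hc0 : 0 <= c) by nra.
  pose proof (sqdist_dual_arc f p Hf) as E. fold c V in E.
  (* stationarity: [(B p, c)] is parallel to [(- B f, V)] *)
  assert (Hpar : B p * V = - (c * B f)).
  { destruct (Req_dec c 0) as [Z|NZ].
    - rewrite Z in *. assert (Rabs (B p) = 0) by nra.
      destruct (Req_dec (B p) 0) as [->|N]; [lra|]. apply Rabs_no_R0 in N; lra.
    - assert (HD : Rabs (B p) < c) by nra.
      destruct (farthest_dual p HD) as [f' [r [Hf' [Hr [Hr2 Hpf']]]]]. fold c in Hr2, Hpf'.
      specialize (Hall f' Hf').
      assert (Hle : r <= - (Rr * B p * B f - T * c * V)) by lra.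
      assert (Hsq : r * r <= (Rr * B p * B f - T * c * V) * (Rr * B p * B f - T * c * V)) by nra.
      assert (Hid : r * r = (Rr * B p * B f - T * c * V) * (Rr * B p * B f - T * c * V)
          + Rr * T * ((B p * V + c * B f) * (B p * V + c * B f))).
      { rewrite Hr2. replace (Rr + T) with (Rr * (B f * B f) + T * (V * V)) by lra. ring. }
      assert (0 < Rr * T) by nra.
      assert ((B p * V + c * B f) * (B p * V + c * B f) <= 0) by nra.
      assert (B p * V + c * B f = 0) by nra. lra. }
  (* In that plane the ray from [f] crosses the line [xy], at [B = 0] and [G = 1], and reaches the
     level of [p] after [K] times that way. *)
  set (K := 1 + c / V).
  assert (Hcv : 0 <= c / V) by (apply Rle_mult_inv_pos; lra).
  assert (EcV : c / V * V = c) by (field; lra).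
  assert (HK : 1 <= K) by (unfold K; lra).
  assert (Ebp : B p - B f = - K * B f).
  { unfold K. apply Rmult_eq_reg_r with V; [|lra].
    replace ((B p - B f) * V) with (B p * V - B f * V) by ring. rewrite Hpar.
    replace (- (1 + c / V) * B f * V) with (- B f * V - (c / V * V) * B f) by ring.
    rewrite EcV; ring. }
  assert (Ecp : G p - G f = K * V).
  { unfold K. replace ((1 + c / V) * V) with (V + c / V * V) by ring. rewrite EcV.
  unfold c, V; ring. }
  assert (EN : S * (A p * A p) + K * K * (Rr + T) = S + Rr + T).
  { rewrite HSRT, <- Hpf, (sqdist_coords h x y a b Q p f), Ebp, Ecp, fA, <- fE. fold V. ring. }
  assert (HK2 : 1 <= K * K) by nra.
  assert ((K * K - 1) * (Rr + T) >= 0) by nra.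
  assert (HA2 : A p * A p <= 1) by nra.
  assert (HA1 : -1 <= A p <= 1) by nra.
  assert (Ep : p = comb f x y ((K - A p) / 2) ((K + A p) / 2)).
  { apply (coords_inj h x y a b Q);
    destruct (coords_comb x y a b f x y ((K - A p) / 2) ((K + A p) / 2)) as [cA' [cB' cG']];
    rewrite ?cA', ?cB', ?cG';
    destruct (coords_x h x y a b Q) as [xA [xB xG]],
      (coords_y h x y a b Q) as [yA [yB yG]];
    rewrite ?fA, ?xA, ?xB, ?xG, ?yA, ?yB, ?yG.
    - field.
    - transitivity (B f - K * B f); [lra|field].
    - transitivity (G f + K * V); [lra|unfold V; field]. }
  rewrite Ep. apply minor_arc_intro; try lra. rewrite <- Ep; auto.
Qed.

End Geo.

Lemma pset_ext (A B : pset) : (forall p, A p <-> B p) -> A = B.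
Proof.
  intros H; apply functional_extensionality; intros p; apply propositional_extensionality; auto.
Qed.

Lemma arc_ends (A : pset) (p q : pt) : is_arc A p q -> A p /\ A q /\ p <> q.
Proof.
  intros [g [c [n [r [Hg [Hinj [H0 [H1 [HA _]]]]]]]]]. split; [|split].
  - apply HA; exists 0; split; [lra|auto].
  - apply HA; exists 1; split; [lra|auto].
  - intros E. assert (0 = 1) by (apply Hinj; try lra; congruence). lra.
Qed.

(** * Edges of a Reuleaux polyhedron *)

Section Reuleaux.
Variables (X : list pt) (h : R).
Hypothesis HX : is_reuleaux X h.

Definition Phi : pset := hull h (fun c => In c X).
Definition face_pair (a b : pt) : pset := fun z => face X h a z /\ face X h b z.

Lemma radius_pos : 0 < h.
Proof. apply HX. Qed.

Lemma Phi_eq : ball_poly X h = Phi.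
Proof. apply ball_poly_hull, radius_pos. Qed.

Lemma face_iff (c p : pt) : face X h c p <-> sqdist p c = h * h /\ Phi p.
Proof.
  unfold face. rewrite Phi_eq, (sphere_sqdist h c p radius_pos), sqdist_sym. tauto.
Qed.

Lemma face_pair_iff (a b p : pt) : face_pair a b p <-> sqdist p a = h * h /\ sqdist p b = h * h /\
    Phi p.
Proof. unfold face_pair; rewrite !face_iff; tauto. Qed.

Lemma boundary_iff (p : pt) : boundary (ball_poly X h) p <-> Phi p /\ exists c, In c X /\ sqdist p
    c = h * h.
Proof. rewrite Phi_eq. apply boundary_finite_hull, radius_pos. Qed.

Lemma vertex_iff (y : pt) : zero_singular X h y <-> In y X.
Proof. apply HX. Qed.

Lemma X_Phi (y : pt) : In y X -> Phi y.
Proof. intros Hy. apply vertex_iff in Hy as [Hb _]. apply boundary_iff in Hb. tauto. Qed.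

Lemma X_diam (x y : pt) : In x X -> In y X -> sqdist x y <= h * h.
Proof. intros Hx Hy. exact (X_Phi x Hx y Hy). Qed.

Lemma X_neighbour (c : pt) : In c X -> exists v, In v X /\ sqdist v c = h * h.
Proof.
  intros Hc. apply vertex_iff in Hc as [_ [x1 [_ [_ [H1 [_ [_ [S1 _]]]]]]]].
  exists x1; split; auto. rewrite sqdist_sym. now apply (sphere_sqdist h c x1 radius_pos).
Qed.

Lemma X_distinct : exists c v, In c X /\ In v X /\ c <> v.
Proof.
  destruct HX as [[[_ [_ [Hl _]]] _] _].
  destruct X as [|c L] eqn:E; [simpl in Hl; lia|]. rewrite <- E in *.
  assert (Hc : In c X) by (rewrite E; now left).
  destruct (X_neighbour c Hc) as [v [Hv HD]]. exists c, v; repeat split; auto.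
  intros <-. rewrite sqdist_refl in HD. pose proof radius_pos. nra.
Qed.

Lemma std_cases (a b : pt) : In a X -> In b X -> a <> b ->
  (forall z, ~ face_pair a b z) \/ (exists v, In v X /\ forall z, face_pair a b z <-> z = v) \/
  (exists x y, is_edge X h (face_pair a b) x y).
Proof.
  intros Ha Hb Hab. destruct HX as [[_ Hs] Hz]. destruct (Hs a b Ha Hb Hab) as [H|[[v [Hv H]]|H]].
  - left; exact H.
  - right; left; exists v; split; [now apply Hz|exact H].
  - right; right; exact H.
Qed.

Lemma edge_facts (E : pset) (x y : pt) : is_edge X h E x y ->
  E x /\ E y /\ x <> y /\ In x X /\ In y X /\ (forall z, E z -> In z X -> z = x \/ z = y).
Proof.
  intros [Harc [Hx [Hy [_ Hz]]]]. destruct (arc_ends _ _ _ Harc) as [Ex [Ey Hxy]].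
  repeat split; auto; try now apply vertex_iff.
  intros z Ez Hin. apply NNPP; intros Hn. apply (Hz z Ez); [tauto|tauto|now apply vertex_iff].
Qed.

Lemma edge_rev (E : pset) (x y : pt) : is_edge X h E x y -> is_edge X h E y x.
Proof.
  intros [H1 [H2 [H3 [H4 H5]]]]. split; [now apply is_arc_rev|]. split; [exact H3|].
  split; [exact H2|]. split; [exact H4|]. intros z Hz Hx Hy; now apply H5.
Qed.

Lemma face_pair_sym (a b : pt) : face_pair a b = face_pair b a.
Proof. apply pset_ext; intros; unfold face_pair; tauto. Qed.

(** For [p] on the faces of [c1] and [c3], [sqdist_comb] reads [0 = m (|p c2|^2 - h^2) + (1 - l - m)
    |z p|^2]. Both terms are nonpositive and [l + m > 1], so [p = z]. Two faces with a single common
    point meet in a vertex, which [z] is not. *)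
Lemma middle_centre (z c1 c2 c3 : pt) (l m : R) :
  Phi z -> ~ In z X -> In c1 X -> In c2 X -> In c3 X -> c1 <> c3 -> c2 <> c3 ->
  sqdist z c1 = h * h -> sqdist z c2 = h * h -> sqdist z c3 = h * h ->
  0 <= l -> 0 <= m -> c3 = comb z c1 c2 l m -> False.
Proof.
  intros Pz NX I1 I2 I3 N13 N23 H1 H2 H3 Hl Hm E. pose proof radius_pos as Hh.
  assert (Hhh : 0 < h * h) by nra.
  (* The degenerate cases identify [c3] with [c1] or [c2]; otherwise three distinct centres on one
     sphere about [z] force [l + m > 1]. *)
  pose proof (sqdist_comb_c z c1 c2 l m) as EC. rewrite <- E in EC.
  rewrite (sqdist_sym c3), (sqdist_sym c1 z), (sqdist_sym c2 z), H1, H2, H3 in EC.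
  destruct (Req_dec l 0) as [Zl|Zl].
  { subst l. assert (m * m = 1) by (apply Rmult_eq_reg_r with (h * h); lra).
    assert (m = 1) by nra. subst m. apply N23. rewrite E. clear; veq. }
  destruct (Req_dec m 0) as [Zm|Zm].
  { subst m. assert (l * l = 1) by (apply Rmult_eq_reg_r with (h * h); lra).
    assert (l = 1) by nra. subst l. apply N13. rewrite E. clear; veq. }
  destruct (pt_eq_or_neq c1 c2) as [E12|N12].
  { subst c2. rewrite sqdist_refl in EC.
    assert ((l + m) * (l + m) = 1) by (apply Rmult_eq_reg_r with (h * h); lra).
    assert (l + m = 1) by nra. apply N13. rewrite E. replace l with (1 - m) by lra. clear; veq. }
  assert (Hlm : 1 < l + m).
  { assert (0 < l * m * sqdist c1 c2).
    { apply Rmult_lt_0_compat; [nra|now apply sqdist_pos]. }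
    assert (1 < (l + m) * (l + m)) by (apply Rmult_lt_reg_r with (h * h); lra). nra. }
  assert (U : forall p, face_pair c1 c3 p -> p = z).
  { intros p Hp. apply face_pair_iff in Hp as [P1 [P3 Pp]]. pose proof (Pp c2 I2) as P2.
    pose proof (sqdist_comb z c1 c2 p l m) as EP. rewrite <- E in EP.
    rewrite (sqdist_sym c3 p), (sqdist_sym c3 z), (sqdist_sym c1 p), (sqdist_sym c1 z), (sqdist_sym
        c2 p), (sqdist_sym c2 z),
      P1, P3, H1, H2, H3 in EP.
    pose proof (sqdist_nonneg z p). symmetry. apply sqdist_eq0. nra. }
  assert (Iz : face_pair c1 c3 z) by (apply face_pair_iff; auto).
  destruct (std_cases c1 c3 I1 I3 N13) as [H|[[v [Hv H]]|[x [y H]]]].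
  - now apply (H z).
  - apply H in Iz. subst; auto.
  - apply edge_facts in H as [Ex [Ey [Hxy _]]]. apply U in Ex; apply U in Ey. congruence.
Qed.

(** Centres are at most [h] apart, so from [z] they are seen under an angle of at most 60
    degrees. *)
Lemma dot_centres (z c1 c2 : pt) : Phi z -> In c1 X -> In c2 X ->
  sqdist z c1 = h * h -> sqdist z c2 = h * h -> 0 < dot (vsub c1 z) (vsub c2 z).
Proof.
  intros Pz I1 I2 H1 H2. pose proof (X_diam c1 c2 I1 I2). pose proof radius_pos.
  assert (E : 2 * dot (vsub c1 z) (vsub c2 z) = sqdist z c1 + sqdist z c2 - sqdist c1 c2) by
      (clear; vring).
  rewrite H1, H2 in E. nra.
Qed.

(** As [z] is not a vertex, the three directions are dependent. Their inner products are positive,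
    so the coefficients cannot all have one sign; one centre then lies in the cone of the other two,
    which [middle_centre] forbids. *)
Lemma two_spheres (z c1 c2 c3 : pt) :
  Phi z -> ~ In z X -> In c1 X -> In c2 X -> In c3 X -> c1 <> c2 -> c1 <> c3 -> c2 <> c3 ->
  sqdist z c1 = h * h -> sqdist z c2 = h * h -> sqdist z c3 = h * h -> False.
Proof.
  intros Pz NX I1 I2 I3 N12 N13 N23 H1 H2 H3. pose proof radius_pos as Hh.
  assert (Hd : ~ lin_indep3 (vsub c1 z) (vsub c2 z) (vsub c3 z)).
  { intros Hi. apply NX, vertex_iff. split; [apply boundary_iff; eauto|].
    exists c1, c2, c3. do 3 (split; [assumption|]).
    do 3 (split; [now apply (sphere_sqdist h z)|]). exact Hi. }
  unfold lin_indep3 in Hd. apply not_all_ex_not in Hd as [al Hd].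
  apply not_all_ex_not in Hd as [be Hd]. apply not_all_ex_not in Hd as [ga Hd].
  apply imply_to_and in Hd as [E0 Hd].
  pose proof (dot_centres z c1 c2 Pz I1 I2 H1 H2) as G12.
  pose proof (dot_centres z c1 c3 Pz I1 I3 H1 H3) as G13.
  pose proof (dot_centres z c2 c3 Pz I2 I3 H2 H3) as G23.
  pose proof (dot_centres z c1 c1 Pz I1 I1 H1 H1) as G11.
  pose proof (dot_centres z c2 c2 Pz I2 I2 H2 H2) as G22.
  pose proof (dot_centres z c3 c3 Pz I3 I3 H3 H3) as G33.
  assert (ED : forall w, al * dot (vsub c1 z) w + be * dot (vsub c2 z) w + ga * dot (vsub c3 z) w =
      0).
  { intros w. transitivity (dot (vadd (vadd (vscal al (vsub c1 z)) (vscal be (vsub c2 z)))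
       (vscal ga (vsub c3 z))) w); [clear; vring|]. rewrite E0. clear; vring. }
  assert (EL : forall u v w r s, vadd (vadd (vscal r (vsub u z)) (vscal s (vsub v z))) (vscal (-1)
      (vsub w z)) = vzero
     -> w = comb z u v r s).
  { intros u v w r s E. symmetry. apply vsub_eq0. rewrite <- E. clear; veq. }
  assert (SC : forall k, vadd (vadd (vscal (k * al) (vsub c1 z)) (vscal (k * be) (vsub c2 z)))
     (vscal (k * ga) (vsub c3 z)) = vzero).
  { intros k. transitivity (vscal k (vadd (vadd (vscal al (vsub c1 z)) (vscal be (vsub c2 z)))
       (vscal ga (vsub c3 z)))); [clear; veq|]. rewrite E0. clear; veq. }
  pose proof (ED (vsub c1 z)) as D1. pose proof (ED (vsub c2 z)) as D2'.
  pose proof (ED (vsub c3 z)) as D3.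
  rewrite (dot_sym (vsub c2 z) (vsub c1 z)), (dot_sym (vsub c3 z) (vsub c1 z)) in D1.
  rewrite (dot_sym (vsub c3 z) (vsub c2 z)) in D2'.
  (* isolate the centre whose coefficient has a sign opposite to the other two *)
  assert (K3 : ga < 0 -> 0 <= al -> 0 <= be -> False).
  { intros. assert (0 < - / ga) by (pose proof (Rinv_lt_0_compat ga H); lra).
    apply (middle_centre z c1 c2 c3 (- / ga * al) (- / ga * be)); auto; try nra.
    apply EL. rewrite <- (SC (- / ga)). repeat f_equal. field. lra. }
  assert (K2 : be < 0 -> 0 <= al -> 0 <= ga -> False).
  { intros. assert (0 < - / be) by (pose proof (Rinv_lt_0_compat be H); lra).
    apply (middle_centre z c1 c3 c2 (- / be * al) (- / be * ga)); auto; try nra.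
    apply EL. rewrite <- (SC (- / be)). replace (- / be * be) with (-1) by (field; lra).
    generalize (- / be * al) (- / be * ga). clear. veq. }
  assert (K1 : al < 0 -> 0 <= be -> 0 <= ga -> False).
  { intros. assert (0 < - / al) by (pose proof (Rinv_lt_0_compat al H); lra).
    apply (middle_centre z c2 c3 c1 (- / al * be) (- / al * ga)); auto; try nra.
    apply EL. rewrite <- (SC (- / al)). replace (- / al * al) with (-1) by (field; lra).
    generalize (- / al * be) (- / al * ga). clear. veq. }
  assert (K3' : 0 < ga -> al <= 0 -> be <= 0 -> False).
  { intros. assert (0 < / ga) by (now apply Rinv_0_lt_compat).
    apply (middle_centre z c1 c2 c3 (/ ga * - al) (/ ga * - be)); auto; try nra.
    apply EL. rewrite <- (SC (- / ga)). replace (- / ga * ga) with (-1) by (field; lra).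
    generalize (/ ga). clear. veq. }
  assert (K2' : 0 < be -> al <= 0 -> ga <= 0 -> False).
  { intros. assert (0 < / be) by (now apply Rinv_0_lt_compat).
    apply (middle_centre z c1 c3 c2 (/ be * - al) (/ be * - ga)); auto; try nra.
    apply EL. rewrite <- (SC (- / be)). replace (- / be * be) with (-1) by (field; lra).
    generalize (/ be). clear. veq. }
  assert (K1' : 0 < al -> be <= 0 -> ga <= 0 -> False).
  { intros. assert (0 < / al) by (now apply Rinv_0_lt_compat).
    apply (middle_centre z c2 c3 c1 (/ al * - be) (/ al * - ga)); auto; try nra.
    apply EL. rewrite <- (SC (- / al)). replace (- / al * al) with (-1) by (field; lra).
    generalize (/ al). clear. veq. }
  destruct (Rtotal_order al 0) as [A|[A|A]], (Rtotal_order be 0) as [B|[B|B]],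
    (Rtotal_order ga 0) as [C|[C|C]];
  first [ tauto | (exfalso; apply K1; lra) | (exfalso; apply K2; lra) | (exfalso; apply K3; lra)
    | (exfalso; apply K1'; lra) | (exfalso; apply K2'; lra) | (exfalso; apply K3'; lra) | nra |
        idtac ].
Qed.

Lemma edge_of_two (a b p q : pt) : In a X -> In b X -> a <> b -> face_pair a b p -> face_pair a b q
    -> p <> q ->
  exists x y, is_edge X h (face_pair a b) x y.
Proof.
  intros Ha Hb Hab Hp Hq Hpq. destruct (std_cases a b Ha Hb Hab) as [H|[[v [Hv H]]|H]]; auto.
  - exfalso; now apply (H p). - apply H in Hp; apply H in Hq. congruence.
Qed.

Lemma edge_of_nonvertex (a b p : pt) : In a X -> In b X -> a <> b -> face_pair a b p -> ~ In p X ->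
  exists x y, is_edge X h (face_pair a b) x y.
Proof.
  intros Ha Hb Hab Hp Hn. destruct (std_cases a b Ha Hb Hab) as [H|[[v [Hv H]]|H]]; auto.
  - exfalso; now apply (H p). - apply H in Hp. congruence.
Qed.

Lemma edge_quad (a b x y : pt) : In a X -> In b X -> a <> b -> is_edge X h (face_pair a b) x y ->
  quad h x y a b.
Proof.
  intros Ha Hb Hab He. apply edge_facts in He as [Ex [Ey [Hxy [Hx [Hy _]]]]].
  apply face_pair_iff in Ex as [? [? _]]. apply face_pair_iff in Ey as [? [? _]].
  pose proof (X_diam a b Ha Hb). pose proof (X_diam x y Hx Hy). pose proof radius_pos.
  unfold quad; tauto.
Qed.

Lemma face_pair_near (a b x y p : pt) : In x X -> In y X -> face_pair a b p -> near_edge h x y a b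
    p.
Proof. intros Hx Hy Hp. apply face_pair_iff in Hp as [H1 [H2 H3]]. repeat split; auto. Qed.

(** Identifies the edge, known only as some circular arc, with the explicit one: injectivity keeps
    the parametrisation inside the arc and the intermediate value theorem makes it fill the arc. *)
Lemma edge_arc (a b x y : pt) : In a X -> In b X -> a <> b -> is_edge X h (face_pair a b) x y ->
  forall p, face_pair a b p <-> upper_arc x y a b p.
Proof.
  intros Ha Hb Hab He p. pose proof (edge_quad a b x y Ha Hb Hab He) as Q.
  pose proof (edge_facts _ _ _ He) as [_ [_ [_ [Hx [Hy _]]]]].
  destruct He as [[g [c [n [r [Hg [Hinj [H0 [H1 [HA _]]]]]]]]] _].
  assert (Hn : forall t, 0 <= t <= 1 -> near_edge h x y a b (g t)).
  { intros t Ht. apply face_pair_near; auto. apply HA; eauto. }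
  split.
  - intros Hp. apply HA in Hp as [t [Ht ->]]. apply (path_in_arc h x y a b Q g); auto.
  - intros Hp. destruct (path_covers_arc h x y a b Q g p) as [t [Ht <-]]; auto.
    apply HA; eauto.
Qed.

(** Both [a] and [b] lie on the faces of [x] and [y]. Faces with two common points share an edge,
    and the only vertices on an edge are its ends. *)
Lemma dual_edge (a b x y : pt) : In a X -> In b X -> a <> b -> is_edge X h (face_pair a b) x y ->
  is_edge X h (face_pair x y) a b.
Proof.
  intros Ha Hb Hab He. pose proof (edge_facts _ _ _ He) as [Ex [Ey [Hxy [Hx [Hy _]]]]].
  apply face_pair_iff in Ex as [X1 [X2 _]]. apply face_pair_iff in Ey as [Y1 [Y2 _]].
  assert (Ia : face_pair x y a) by (apply face_pair_iff; rewrite (sqdist_sym a x), (sqdist_sym a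
      y); auto using X_Phi).
  assert (Ib : face_pair x y b) by (apply face_pair_iff; rewrite (sqdist_sym b x), (sqdist_sym b
      y); auto using X_Phi).
  destruct (edge_of_two x y a b Hx Hy Hxy Ia Ib Hab) as [u [v Huv]].
  destruct (edge_facts _ _ _ Huv) as [_ [_ [Nuv [_ [_ HZ]]]]].
  destruct (HZ a Ia Ha) as [->| ->], (HZ b Ib Hb) as [->| ->]; try congruence.
  now apply edge_rev.
Qed.

(* Away from the vertices exactly two balls touch, so the pair of faces is locally constant
   along an edge. *)
Lemma edge_is_face_pair (F : pset) (a b : pt) : is_edge X h F a b ->
  exists c1 c2, In c1 X /\ In c2 X /\ c1 <> c2 /\ F = face_pair c1 c2.
Proof.
  intros He. pose proof (edge_facts _ _ _ He) as [_ [_ [Nab [Ha [Hb HZ]]]]].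
  pose proof radius_pos as Hh.
  destruct He as [[g [c [n [r [Hg [Hinj [H0 [H1 [HF _]]]]]]]]] [_ [_ [Hs _]]]].
  assert (Hsing : forall t, 0 <= t <= 1 -> Phi (g t) /\ exists c1 c2, In c1 X /\ In c2 X /\ c1 <> c2
     /\ sqdist (g t) c1 = h * h /\ sqdist (g t) c2 = h * h).
  { intros t Ht. destruct (Hs (g t)) as [Hbd [c1 [c2 [I1 [I2 [N [S1 S2]]]]]]]; [apply HF; eauto|].
    apply boundary_iff in Hbd as [HP _]. split; auto. exists c1, c2.
    apply (sphere_sqdist h c1 _ Hh) in S1; apply (sphere_sqdist h c2 _ Hh) in S2.
    rewrite sqdist_sym in S1; rewrite sqdist_sym in S2. repeat split; auto. }
  assert (HnX : forall t, 0 < t < 1 -> ~ In (g t) X).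
  { intros t Ht Hin. destruct (HZ (g t)) as [E|E]; auto.
    - apply HF; exists t; split; [lra|auto].
    - rewrite <- H0 in E. apply Hinj in E; lra.
    - rewrite <- H1 in E. apply Hinj in E; lra. }
  destruct (Hsing (1/2) ltac:(lra)) as [_ [c1 [c2 [I1 [I2 [N12 [S1 S2]]]]]]].
  set (P := fun t => sqdist (g t) c1 = h * h /\ sqdist (g t) c2 = h * h).
  assert (Hpair : forall t, 0 < t < 1 -> P t -> forall c3, In c3 X -> sqdist (g t) c3 = h * h ->
     c3 = c1 \/ c3 = c2).
  { intros t Ht [P1 P2] c3 I3 S3. apply NNPP; intros Hn.
    apply (two_spheres (g t) c1 c2 c3); auto; try (intros ->; tauto).
    apply Hsing; lra. }
  assert (Hopen : forall t, 0 < t < 1 -> exists d, 0 < d /\ forall s, 0 <= s <= 1 ->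
     Rabs (s - t) < d -> forall c3, In c3 X -> sqdist (g s) c3 = h * h -> sqdist (g t) c3 = h * h).
  { intros t Ht. destruct (finite_strict_margin X h (g t) Hh) as [e [He HE]].
    destruct (Hg t ltac:(lra) e He) as [d [Hd HD]]. exists d; split; auto.
    intros s Hs' Hst c3 I3 S3. specialize (HD s Hs' Hst). rewrite dist_sym in HD.
    destruct (Hsing t ltac:(lra)) as [HP _].
    destruct (Rle_lt_or_eq_dec _ _ (HP c3 I3)) as [Hlt|]; auto.
    specialize (HE c3 I3 Hlt (g s) HD). lra. }
  assert (Hloc : forall t, 0 < t < 1 -> exists d, 0 < d /\ forall s, 0 < s < 1 ->
     Rabs (s - t) < d -> (P s <-> P t)).
  { intros t Ht. destruct (Hopen t Ht) as [d [Hd HD]]. exists d; split; auto.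
    intros s Hs' Hst. split.
    - intros [P1 P2]. split; apply (HD s); auto; lra.
    - intros PT. destruct (Hsing s ltac:(lra)) as [_ [d1 [d2 [J1 [J2 [ND [Q1 Q2]]]]]]].
      pose proof (HD s ltac:(lra) Hst d1 J1 Q1) as T1.
      pose proof (HD s ltac:(lra) Hst d2 J2 Q2) as T2.
      destruct (Hpair t Ht PT d1 J1 T1) as [->| ->], (Hpair t Ht PT d2 J2 T2) as [->| ->];
        try congruence; split; auto. }
  assert (Hall : forall t, 0 < t < 1 -> P t).
  { intros t Ht. destruct (Rle_lt_dec (1/2) t) as [Hle|Hlt].
    - apply (clopen_interval P (1/2) t); auto; [|split; auto].
      intros s Hs'. destruct (Hloc s ltac:(lra)) as [d [Hd HD]]. exists d; split; auto.
      intros s' Hs'' Hd'. apply HD; auto; lra.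
    (* [clopen_interval] propagates to the right only, so to the left of 1/2 the failure of [P] is
       carried from [t] to 1/2. *)
    - apply NNPP; intros Hn.
    apply (clopen_interval (fun s => ~ P s) t (1/2)); auto; [lra| |split; auto].
      intros s Hs'. destruct (Hloc s ltac:(lra)) as [d [Hd HD]]. exists d; split; auto.
      intros s' Hs'' Hd'. rewrite (HD s'); [tauto| lra|auto]. }
  assert (Hends : forall c3, (forall t, 0 < t < 1 -> sqdist (g t) c3 = h * h) ->
     forall t, 0 <= t <= 1 -> sqdist (g t) c3 = h * h).
  { intros c3 H3 t Ht. destruct (Req_dec t 0) as [->|T0]; [|destruct (Req_dec t 1) as [->|T1]];
      [| |apply H3; lra].
    all: apply dist_eq_iff; [lra|]; apply NNPP; intros Hne.
    - destruct (path_lipschitz_cont g (fun p => dist p c3) Hg (lipschitz_dist c3) 0 ltac:(lra)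
        (Rabs (h - dist (g 0) c3))) as [d [Hd HD]]; [apply Rabs_pos_lt; lra|].
      set (s := Rmin (d / 2) (1 / 2)).
      assert (0 < s) by (apply Rmin_pos; lra).
      pose proof (Rmin_l (d / 2) (1 / 2)); pose proof (Rmin_r (d / 2) (1 / 2)). fold s in H2, H4.
      assert (Es : dist (g s) c3 = h) by (apply dist_eq_iff; [lra|]; apply H3; lra).
      specialize (HD s ltac:(lra)). rewrite Es in HD.
      apply (Rlt_irrefl (Rabs (h - dist (g 0) c3))), HD. rewrite Rminus_0_r, Rabs_right; lra.
    - destruct (path_lipschitz_cont g (fun p => dist p c3) Hg (lipschitz_dist c3) 1 ltac:(lra)
        (Rabs (h - dist (g 1) c3))) as [d [Hd HD]]; [apply Rabs_pos_lt; lra|].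
      set (s := Rmin (d / 2) (1 / 2)).
      assert (0 < s) by (apply Rmin_pos; lra).
      pose proof (Rmin_l (d / 2) (1 / 2)); pose proof (Rmin_r (d / 2) (1 / 2)). fold s in H2, H4.
      assert (Es : dist (g (1 - s)) c3 = h) by (apply dist_eq_iff; [lra|]; apply H3; lra).
      specialize (HD (1 - s) ltac:(lra)). rewrite Es in HD.
      apply (Rlt_irrefl (Rabs (h - dist (g 1) c3))), HD.
      replace (1 - s - 1) with (- s) by ring. rewrite Rabs_Ropp, Rabs_right; lra. }
  assert (HI : forall t, 0 <= t <= 1 -> face_pair c1 c2 (g t)).
  { intros t Ht. apply face_pair_iff. split; [|split]; [| |apply Hsing; auto];
      apply Hends; auto; intros s Hs'; now apply Hall. }
  assert (Ia : face_pair c1 c2 a) by (rewrite <- H0; apply HI; lra).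
  assert (Ib : face_pair c1 c2 b) by (rewrite <- H1; apply HI; lra).
  exists c1, c2. repeat split; auto. apply pset_ext; intros p. split.
  - intros Fp. apply HF in Fp as [t [Ht ->]]. auto.
  - intros Ip. destruct (edge_of_two c1 c2 a b I1 I2 N12 Ia Ib Nab) as [u [v Huv]].
    assert (Hedge : is_edge X h (face_pair c1 c2) a b).
    { destruct (edge_facts _ _ _ Huv) as [_ [_ [_ [_ [_ HZ']]]]].
      destruct (HZ' a Ia Ha) as [->| ->], (HZ' b Ib Hb) as [->| ->]; try congruence.
      now apply edge_rev. }
    apply (edge_arc c1 c2 a b I1 I2 N12 Hedge) in Ip.
    destruct (path_covers_arc h a b c1 c2 (edge_quad c1 c2 a b I1 I2 N12 Hedge) g p)
      as [t [Ht <-]]; auto.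
    + intros t Ht. apply face_pair_near; auto.
    + apply HF; eauto.
Qed.

(** [dual_data] asks of [F] only to be an edge from [a] to [b]. Being the common part of two faces,
    with centres on both spheres of [a] and [b], it has as centres the two vertices of [E], so [F]
    is determined. *)
Lemma dual_data_iff (E F : pset) (x y a b : pt) :
  dual_data X h E x y F a b <->
  In a X /\ In b X /\ a <> b /\ is_edge X h (face_pair a b) x y /\ E = face_pair a b /\ F =
      face_pair x y.
Proof.
  split.
  - intros [HE [HF [Ha [Hb HI]]]]. assert (EI : E = face_pair a b) by (apply pset_ext; exact HI).
    pose proof (edge_facts _ _ _ HF) as [Fa [Fb [Nab _]]]. subst E.
    do 3 (split; [assumption|]). split; [exact HE|]. split; [reflexivity|].
    destruct (edge_is_face_pair F a b HF) as [c1 [c2 [I1 [I2 [N12 EF]]]]]. subst F.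
    apply face_pair_iff in Fa as [A1 [A2 _]]. apply face_pair_iff in Fb as [B1 [B2 _]].
    destruct (edge_facts _ _ _ HE) as [_ [_ [_ [_ [_ HZ]]]]].
    assert (J1 : face_pair a b c1) by (apply face_pair_iff; rewrite (sqdist_sym c1 a), (sqdist_sym
        c1 b); auto using X_Phi).
    assert (J2 : face_pair a b c2) by (apply face_pair_iff; rewrite (sqdist_sym c2 a), (sqdist_sym
        c2 b); auto using X_Phi).
    destruct (HZ c1 J1 I1) as [->| ->], (HZ c2 J2 I2) as [->| ->]; try congruence.
    now rewrite face_pair_sym.
  - intros [Ha [Hb [Nab [He [-> ->]]]]]. split; auto. split; [now apply dual_edge|].
    do 2 (split; [assumption|]). intros z; reflexivity.
Qed.

End Reuleaux.

(** * Great circles *)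

(** Squared length of the point [(1 - t) (u - c) + t (v - c)] of the chord line. [geo] projects this
    line radially to the sphere for every real [t], so it continues the minor arc beyond [u] and
    [v]. *)
Definition geo_norm (h : R) (c u v : pt) (t : R) : R :=
  h * h * ((1 - t) * (1 - t) + t * t) + 2 * t * (1 - t) * dot (vsub u c) (vsub v c).

Definition geo_scale (h : R) (c u v : pt) (t : R) : R := h * / sqrt (geo_norm h c u v t).

Definition geo (h : R) (c u v : pt) (t : R) : pt :=
  comb c u v (geo_scale h c u v t * (1 - t)) (geo_scale h c u v t * t).

(** The strict bounds say that [u] and [v] are neither equal nor antipodal, so they span a great
    circle. *)
Definition geo_ok (h : R) (c u v : pt) : Prop :=
  0 < h /\ sqdist u c = h * h /\ sqdist v c = h * h /\
  - (h * h) < dot (vsub u c) (vsub v c) < h * h.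

Lemma geo_ok_intro (h : R) (c u v n : pt) : 0 < h -> sqdist u c = h * h -> sqdist v c = h * h -> u
    <> v ->
  0 < dot n (vsub u c) -> 0 < dot n (vsub v c) -> geo_ok h c u v.
Proof.
  intros Hh Hu Hv Huv Nu Nv. repeat split; auto.
  - apply Rnot_le_lt; intros Hle.
    assert (E : vadd (vsub u c) (vsub v c) = vzero).
    { apply dot_self_eq0, Rle_antisym; [|apply dot_self_nonneg].
      replace (dot (vadd (vsub u c) (vsub v c)) (vadd (vsub u c) (vsub v c)))
        with (sqdist u c + sqdist v c + 2 * dot (vsub u c) (vsub v c)) by (clear; vring). lra. }
    assert (dot n (vsub u c) + dot n (vsub v c) = 0); [|lra].
    transitivity (dot n (vadd (vsub u c) (vsub v c))); [clear; vring|]. rewrite E; clear; vring.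
  - pose proof (sqdist_pos u v Huv).
    assert (E : sqdist u v = sqdist u c + sqdist v c - 2 * dot (vsub u c) (vsub v c)) by (clear;
        vring). lra.
Qed.

Lemma geo_norm_pos (h : R) (c u v : pt) (t : R) : geo_ok h c u v -> 0 < geo_norm h c u v t.
Proof.
  intros [Hh [_ [_ Hg]]]. unfold geo_norm. set (g := dot (vsub u c) (vsub v c)) in *.
  replace (h * h * ((1 - t) * (1 - t) + t * t) + 2 * t * (1 - t) * g)
    with ((h * h + g) * (1 / 2) + (h * h - g) / 2 * ((1 - 2 * t) * (1 - 2 * t))) by field.
  pose proof (Rle_0_sqr (1 - 2 * t)); unfold Rsqr in *. nra.
Qed.

Lemma geo_scale_pos (h : R) (c u v : pt) (t : R) : geo_ok h c u v -> 0 < geo_scale h c u v t.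
Proof.
  intros H. apply Rmult_lt_0_compat; [apply H|]. apply Rinv_0_lt_compat, sqrt_lt_R0.
  now apply geo_norm_pos.
Qed.

Lemma geo_sphere (h : R) (c u v : pt) (t : R) : geo_ok h c u v -> sqdist (geo h c u v t) c = h * h.
Proof.
  intros H. pose proof (geo_norm_pos h c u v t H) as Hn. destruct H as [Hh [Hu [Hv _]]].
  assert (E : sqdist (geo h c u v t) c =
    geo_scale h c u v t * geo_scale h c u v t * geo_norm h c u v t).
  { unfold geo. rewrite sqdist_comb_c.
    assert (E : sqdist u v = sqdist u c + sqdist v c - 2 * dot (vsub u c) (vsub v c)) by (clear;
        vring).
    rewrite E, Hu, Hv. unfold geo_norm. ring. }
  rewrite E. unfold geo_scale. rewrite <- (sqrt_sqrt (geo_norm h c u v t)) at 3 by lra.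
  assert (0 < sqrt (geo_norm h c u v t)) by now apply sqrt_lt_R0. field. lra.
Qed.

Lemma geo_scale_ends (h : R) (c u v : pt) (t : R) : 0 < h -> t = 0 \/ t = 1 ->
  geo_scale h c u v t = 1.
Proof.
  intros Hh Ht. unfold geo_scale.
  replace (geo_norm h c u v t) with (h * h) by (unfold geo_norm; destruct Ht as [->| ->]; ring).
  rewrite sqrt_square by lra. field; lra.
Qed.

Lemma geo_0 (h : R) (c u v : pt) : 0 < h -> geo h c u v 0 = u.
Proof. intros Hh. unfold geo. rewrite geo_scale_ends by auto. clear; veq. Qed.

Lemma geo_1 (h : R) (c u v : pt) : 0 < h -> geo h c u v 1 = v.
Proof. intros Hh. unfold geo. rewrite geo_scale_ends by auto. clear; veq. Qed.

Lemma comb_cont (c u v : pt) (h l m l' m' e : R) : 0 < h -> 0 < e ->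
  sqdist u c = h * h -> sqdist v c = h * h ->
  Rabs (l - l') < e / (2 * h) -> Rabs (m - m') < e / (2 * h) ->
  dist (comb c u v l m) (comb c u v l' m') < e.
Proof.
  intros Hh He Hu Hv Hl Hm. apply dist_lt_iff; [lra|].
  assert (E : sqdist (comb c u v l m) (comb c u v l' m') =
    (l - l') * (l - l') * sqdist u c + (m - m') * (m - m') * sqdist v c
    + 2 * ((l - l') * (m - m')) * dot (vsub u c) (vsub v c)) by (clear; vring).
  (* Flipping one sign bounds the mixed term by the two squares, whence the factor 2 in
     [e / (2 * h)]. *)
  assert (F : 0 <= sqdist (comb c u v (l - l') (- (m - m'))) c) by apply sqdist_nonneg.
  replace (sqdist (comb c u v (l - l') (- (m - m'))) c) with
    ((l - l') * (l - l') * sqdist u c + (m - m') * (m - m') * sqdist v c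
    - 2 * ((l - l') * (m - m')) * dot (vsub u c) (vsub v c)) in F by (clear; vring).
  rewrite Hu, Hv in *. rewrite E.
  set (r := e / (2 * h)) in *.
  assert (Er : 2 * h * r = e) by (unfold r; field; lra).
  assert (Hsq : forall w, Rabs w < r -> w * w < r * r).
  { intros w Hw. apply Rabs_def2 in Hw. nra. }
  apply Hsq in Hl; apply Hsq in Hm. rewrite <- Er. assert (Hhh : 0 < h * h) by nra.
  apply (Rmult_lt_compat_r (h * h)) in Hl; auto. apply (Rmult_lt_compat_r (h * h)) in Hm; auto. lra.
Qed.

Lemma geo_cont (h : R) (c u v : pt) (t : R) : geo_ok h c u v ->
  forall e, 0 < e -> exists d, 0 < d /\ forall s, Rabs (s - t) < d ->
    dist (geo h c u v s) (geo h c u v t) < e.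
Proof.
  intros H e He. pose proof (geo_norm_pos h c u v t H) as Hn.
  assert (Hs : continuity_pt (fun s => geo_scale h c u v s) t).
  { unfold geo_scale. apply continuity_pt_mult; [apply continuity_pt_const; now intros ? ?|].
    apply continuity_pt_inv.
    - apply (continuity_pt_comp (geo_norm h c u v) sqrt); [|apply continuity_pt_sqrt; lra].
      apply derivable_continuous_pt. unfold geo_norm. reg.
    - apply Rgt_not_eq, sqrt_lt_R0; auto. }
  assert (Hl : continuity_pt (fun s => geo_scale h c u v s * (1 - s)) t).
  { apply continuity_pt_mult; auto. apply derivable_continuous_pt; reg. }
  assert (Hm : continuity_pt (fun s => geo_scale h c u v s * s) t).
  { apply continuity_pt_mult; auto. apply derivable_continuous_pt; reg. }
  destruct H as [Hh [Hu [Hv _]]].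
  assert (0 < e / (2 * h)) by (apply Rdiv_lt_0_compat; lra).
  assert (Hcp : forall f, continuity_pt f t -> exists d, 0 < d /\ forall s, Rabs (s - t) < d ->
     Rabs (f s - f t) < e / (2 * h)).
  { intros f Hf. destruct (Hf (e / (2 * h)) H) as [d [Hd HD]]. exists d; split; auto.
    intros s Hst. destruct (Req_dec s t) as [->|N]; [rewrite Rminus_diag, Rabs_R0; auto|].
    apply (HD s). split; [split; [exact Logic.I|auto]|exact Hst]. }
  destruct (Hcp _ Hl) as [d1 [Hd1 H1]], (Hcp _ Hm) as [d2 [Hd2 H2]].
  exists (Rmin d1 d2); split; [now apply Rmin_pos|]. intros s Hst.
  pose proof (Rmin_l d1 d2); pose proof (Rmin_r d1 d2).
  apply (comb_cont c u v h); auto; [apply H1|apply H2]; lra.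
Qed.

(** Radial projection from [c]; the open half-space given by [n] keeps the cone away from its
    apex. *)
Lemma push_to_sphere (h : R) (c u v n : pt) (l m : R) : 0 < h -> sqdist u c = h * h -> sqdist v c =
    h * h ->
  0 < dot n (vsub u c) -> 0 < dot n (vsub v c) -> 0 <= l -> 0 <= m -> 0 < l + m ->
  exists k, 0 < k /\ sqdist (comb c u v (k * l) (k * m)) c = h * h.
Proof.
  intros Hh Hu Hv Nu Nv Hl Hm Hlm.
  set (N := sqdist (comb c u v l m) c).
  assert (HN : 0 < N).
  { apply sqdist_pos. intros E.
    assert (Z : dot n (vsub (comb c u v l m) c) = 0) by (rewrite E; clear; vring).
    replace (dot n (vsub (comb c u v l m) c)) with (l * dot n (vsub u c) + m * dot n (vsub v c)) in
        Z
      by (clear; vring).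
    assert (0 <= l * dot n (vsub u c)) by (apply Rmult_le_pos; lra).
    assert (0 <= m * dot n (vsub v c)) by (apply Rmult_le_pos; lra).
    assert (l = 0) by (apply (Rmult_eq_reg_r (dot n (vsub u c))); lra).
    assert (m = 0) by (apply (Rmult_eq_reg_r (dot n (vsub v c))); lra). lra. }
  exists (h * / sqrt N). split.
  { apply Rmult_lt_0_compat; auto. now apply Rinv_0_lt_compat, sqrt_lt_R0. }
  replace (sqdist (comb c u v (h * / sqrt N * l) (h * / sqrt N * m)) c)
    with (h * / sqrt N * (h * / sqrt N) * N)
    by (unfold N at 3; generalize (h * / sqrt N); clear; vring).
  rewrite <- (sqrt_sqrt N) at 3 by lra. assert (0 < sqrt N) by now apply sqrt_lt_R0. field; lra.
Qed.

(** * Great circles on a face *)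

Section Body.
Variables (X : list pt) (h : R).
Hypothesis HX : is_reuleaux X h.

Notation Phi := (Phi X h).
Notation face_pair := (face_pair X h).

Lemma dot_ball (c q u : pt) : c <> q -> sqdist u c = h * h -> sqdist u q <= h * h ->
  0 < dot (vsub q c) (vsub u c).
Proof.
  intros N Hu Hq. pose proof (sqdist_pos c q N).
  assert (E : 2 * dot (vsub q c) (vsub u c) = sqdist u c + sqdist c q - sqdist u q) by (clear;
      vring). lra.
Qed.

(** The great circle from [v] is continued past [p] to a last point [p'] of [Phi]. A second sphere
    passes through [p'], and [p] lies on the arc from [v] to [p']. *)
Lemma shoot (c v p : pt) : In c X -> Phi p -> sqdist p c = h * h -> In v X -> sqdist v c = h * h ->
    p <> v ->
  exists z p' l m, In z X /\ z <> c /\ face_pair c z p' /\ 0 <= l /\ 0 < m /\ p = comb c v p' l m.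
Proof.
  intros Hc Hp Hpc Hv Hvc Hpv. pose proof (radius_pos X h HX) as Hh.
  assert (Hhh : 0 < h * h) by nra.
  assert (Ncv : c <> v) by (intros ->; rewrite sqdist_refl in Hvc; lra).
  assert (OK : geo_ok h c v p).
  { apply (geo_ok_intro h c v p (vsub v c)); auto.
    - apply dot_ball; auto. rewrite sqdist_refl; lra.
    - apply dot_ball; auto. }
  set (g := dot (vsub v c) (vsub p c)).
  assert (Hg : h * h <= 2 * g).
  { assert (E : sqdist p v = sqdist p c + sqdist v c - 2 * g) by (unfold g; clear; vring).
    pose proof (Hp v Hv). lra. }
  assert (Hg2 : g < h * h) by apply OK.
  (* At this parameter the direction is perpendicular to [v - c], so the squared distance to [v] is
     twice [h * h] and the point is outside [Phi]. *)
  set (t1 := h * h / (h * h - g)).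
  assert (Et1 : t1 * (h * h - g) = h * h) by (unfold t1; field; lra).
  assert (Ht1 : 1 <= t1) by (apply Rmult_le_reg_r with (h * h - g); lra).
  set (P := fun t => Phi (geo h c v p (1 + t))).
  destruct (last_exit P (t1 - 1)) as [T [HT [PT Hex]]].
  - intros t Hn. destruct (hull_open_compl h _ _ Hh Hn) as [e [He HE]].
    destruct (geo_cont h c v p (1 + t) OK e He) as [d [Hd HD]].
    exists d; split; auto. intros s Hs. apply HE. rewrite dist_sym. apply HD.
    replace (1 + s - (1 + t)) with (s - t) by ring. auto.
  - lra.
  - unfold P. rewrite Rplus_0_r, geo_1; auto.
  - unfold P. replace (1 + (t1 - 1)) with t1 by ring. intros HK. specialize (HK v Hv).
    pose proof (geo_sphere h c v p t1 OK) as HS.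
    assert (E : sqdist (geo h c v p t1) v = sqdist (geo h c v p t1) c + sqdist v c
       - 2 * (geo_scale h c v p t1 * ((1 - t1) * sqdist v c + t1 * g))).
    { unfold geo, g. generalize (geo_scale h c v p t1). clear. vring. }
    rewrite HS, Hvc in E. replace ((1 - t1) * (h * h) + t1 * g) with 0 in E by lra. lra.
  - set (t := 1 + T). set (p' := geo h c v p t).
    assert (Hp'c : sqdist p' c = h * h) by now apply geo_sphere.
    assert (Hz : exists z, In z X /\ z <> c /\ sqdist p' z = h * h).
    (* With only the sphere of [c] through [p'], the other balls leave a margin; as the curve never
       leaves the sphere of [c], it would stay in [Phi] beyond [T]. *)
    { apply NNPP; intros Hn.
      destruct (finite_strict_margin X h p' Hh) as [e [He HE]].
      destruct (geo_cont h c v p t OK e He) as [d [Hd HD]].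
      destruct (Hex d Hd) as [s [Hs Hns]]. apply Hns. intros z Hz.
      destruct (pt_eq_or_neq z c) as [->|Nz]; [right; now apply geo_sphere|].
      left. apply (HE z Hz).
      - destruct (Rle_lt_or_eq_dec _ _ (PT z Hz)) as [|Heq]; auto.
        exfalso. apply Hn. exists z; auto.
      - rewrite dist_sym. apply HD. unfold t. replace (1 + s - (1 + T)) with (s - T) by ring.
        apply Rabs_def1; lra. }
    destruct Hz as [z [Iz [Nz Sz]]].
    pose proof (geo_scale_pos h c v p t OK) as Hk.
    (* The coefficients come from solving the definition of [p'] for [p]. *)
    exists z, p', ((t - 1) / t), (/ (geo_scale h c v p t * t)).
    assert (Ht : 1 <= t) by (unfold t; lra).
    split; auto. split; auto. split; [apply (face_pair_iff X h HX); auto|].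
    split; [apply Rle_mult_inv_pos; lra|]. split; [apply Rinv_0_lt_compat; nra|].
    unfold p', geo. set (k := geo_scale h c v p t) in *.
    assert (E1 : (t - 1) / t + / (k * t) * (k * (1 - t)) = 0) by (field; lra).
    assert (E2 : / (k * t) * (k * t) = 1) by (field; lra).
    transitivity (comb c v p ((t - 1) / t + / (k * t) * (k * (1 - t))) (/ (k * t) * (k * t))).
    { rewrite E1, E2. clear; veq. }
    generalize ((t - 1) / t) (/ (k * t)) (k * (1 - t)) (k * t). clear; veq.
Qed.

(** * The dihedral region over an edge *)

Section Edge.
Variables a b x y : pt.
Hypothesis Ha : In a X.
Hypothesis Hb : In b X.
Hypothesis Hab : a <> b.
Hypothesis He : is_edge X h (face_pair a b) x y.

Let Q : quad h x y a b := edge_quad X h HX a b x y Ha Hb Hab He.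
Let Hx : In x X := proj1 (proj2 (proj2 (proj2 (edge_facts X h HX _ _ _ He)))).
Let Hy : In y X := proj1 (proj2 (proj2 (proj2 (proj2 (edge_facts X h HX _ _ _ He))))).

Notation A := (cA x y a b).
Notation B := (cB x y a b).
Notation G := (cG x y a b).

(** Nonnegative exactly on the dihedral angle opposite to the one spanned by [a] and [b] at the line
    [xy]. Its zeros are two half-planes, one in the plane of [a], [x], [y] and one in that of [b],
    [x], [y]. *)
Definition dihedral_gap (p : pt) : R := G p - 1 - Rabs (B p).

Lemma lipschitz_dihedral_gap : lipschitz dihedral_gap.
Proof.
  destruct (lipschitz_B x y a b) as [M1 [HM1 L1]], (lipschitz_G x y a b) as [M2 [HM2 L2]].
  exists (M1 + M2); split; [lra|]. intros p q. specialize (L1 p q); specialize (L2 p q).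
  unfold dihedral_gap. pose proof (Rabs_triang_inv2 (B p) (B q)) as HT.
  replace (G p - 1 - Rabs (B p) - (G q - 1 - Rabs (B q)))
    with ((G p - G q) + - (Rabs (B p) - Rabs (B q))) by ring.
  eapply Rle_trans; [apply Rabs_triang|]. rewrite Rabs_Ropp. lra.
Qed.

Lemma upper_arc_Phi (e : pt) : upper_arc x y a b e -> Phi e.
Proof. intros H. apply (edge_arc X h HX a b x y) in H; auto. apply (face_pair_iff X h HX) in H.
tauto. Qed.

Lemma sqdist_a_minus_b (p : pt) : sqdist p a - sqdist p b = - 4 * sqj a b * B p.
Proof. rewrite (sqdist_a h x y a b Q), (sqdist_b h x y a b Q). ring. Qed.

Lemma B_sign (p : pt) : sqdist p a = h * h -> sqdist p b <= h * h -> B p <= 0.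
Proof. intros H1 H2. pose proof (sqdist_a_minus_b p). pose proof (R_pos h x y a b Q). nra. Qed.

(** For another [z] the equality case of [dihedral_half] puts [p] on both spheres of [a] and [b],
    hence on the edge. A third sphere through an edge point makes it a vertex, and the only vertices
    there are [x] and [y]. *)
Lemma dihedral_spheres (p z : pt) : Phi p -> In z X -> sqdist p z = h * h -> 0 <= dihedral_gap p ->
  z = a \/ z = b \/ p = x \/ p = y.
Proof.
  intros Pp Hz Hpz HD. unfold dihedral_gap in HD.
  apply NNPP; intros Hn.
  assert (HB : B p = 0 /\ (sqdist p a = h * h \/ sqdist p b = h * h)).
  { destruct (Rle_lt_dec (B p) 0) as [HB|HB].
    - rewrite Rabs_left1 in HD by auto.
      destruct (dihedral_half h x y a b Q p z) as [_ H]; try lra; try apply Pp; auto.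
      + now apply (X_diam X h HX). + intros e Hex; now apply upper_arc_Phi.
      + destruct H; auto.
    - rewrite Rabs_right in HD by lra.
      destruct (dihedral_half h x y b a (quad_swap _ _ _ _ _ Q) p z) as [_ H];
        rewrite ?(cB_swap x y a b), ?(cG_swap x y a b); try lra; try apply Pp; auto.
      + now apply (X_diam X h HX).
      + intros e Hex; apply upper_arc_swap in Hex; now apply upper_arc_Phi.
      + rewrite (cB_swap x y a b) in H. destruct H; auto. split; [lra|auto]. }
  destruct HB as [HB HS]. pose proof (sqdist_a_minus_b p) as E. rewrite HB in E.
  assert (Sa : sqdist p a = h * h) by lra. assert (Sb : sqdist p b = h * h) by lra.
  destruct (classic (In p X)) as [HpX|HpX].
  - pose proof (edge_facts X h HX _ _ _ He) as HZ.
    do 5 apply proj2 in HZ. destruct (HZ p); auto. apply (face_pair_iff X h HX); auto.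
  - apply (two_spheres X h HX p a b z); auto; intros E'; apply Hn; auto.
Qed.

Lemma dihedral_face (p z : pt) : Phi p -> In z X -> sqdist p z = h * h -> 0 <= dihedral_gap p ->
  (B p <= 0 -> sqdist p a = h * h) /\ (0 <= B p -> sqdist p b = h * h).
Proof.
  intros Pp Hz Hpz HD. pose proof (sqdist_a_minus_b p) as E. pose proof (R_pos h x y a b Q) as HR.
  pose proof (Pp a Ha); pose proof (Pp b Hb).
  destruct (dihedral_spheres p z Pp Hz Hpz HD) as [->|[->|[->| ->]]].
  - split; intros; nra.
  - split; intros; nra.
  - split; intros; apply Q.
  - split; intros; apply Q.
Qed.

Lemma dihedral_boundary (p z : pt) : Phi p -> In z X -> sqdist p z = h * h -> dihedral_gap p = 0 ->
  minor_arc a x y h p \/ minor_arc b x y h p.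
Proof.
  intros Pp Hz Hpz HD. destruct (dihedral_face p z Pp Hz Hpz) as [H1 H2]; [lra|].
  unfold dihedral_gap in HD. destruct (Rle_lt_dec (B p) 0) as [HB|HB].
  - left. rewrite Rabs_left1 in HD by auto. apply (minor_arc_of_plane h x y a b Q); auto. lra.
  - right. rewrite Rabs_right in HD by lra.
    apply (minor_arc_of_plane h x y b a (quad_swap _ _ _ _ _ Q)); rewrite ?(cB_swap x y a b),
        ?(cG_swap x y a b); auto; try lra.
Qed.

Lemma minor_arc_dihedral_gap (p : pt) : minor_arc a x y h p \/ minor_arc b x y h p -> dihedral_gap
    p <= 0.
Proof.
  unfold dihedral_gap. intros [H|H].
  - apply (minor_arc_coords h x y a b Q) in H. pose proof (Rle_abs (- B p)).
    rewrite Rabs_Ropp in *. lra.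
  - apply (minor_arc_coords h x y b a (quad_swap _ _ _ _ _ Q)) in H.
    rewrite (cB_swap x y a b), (cG_swap x y a b) in H. pose proof (Rle_abs (B p)). lra.
Qed.

Lemma arc_open_dihedral_gap (e : pt) : upper_arc x y a b e -> e <> x -> e <> y -> 0 < dihedral_gap
    e.
Proof.
  intros Hex Nx Ny. pose proof (upper_arc_inj h x y a b Q e x Hex (upper_arc_x h x y a b Q)) as Ix.
  pose proof (upper_arc_inj h x y a b Q e y Hex (upper_arc_y h x y a b Q)) as Iy.
  destruct (coords_x h x y a b Q) as [Ax _], (coords_y h x y a b Q) as [Ay _].
  pose proof (S_pos h x y a b Q) as HS. pose proof (T_pos h x y a b Q) as HT.
  pose proof (upper_arc_A_range h x y a b Q e Hex) as HA.
  destruct Hex as [HB [HE HG]]. unfold dihedral_gap. rewrite HB, Rabs_R0.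
  destruct (Rle_lt_or_eq_dec _ _ HG) as [|E]; [lra|]. exfalso.
  rewrite <- E in HE. assert (M : (A e - 1) * (A e + 1) = 0) by nra.
  apply Rmult_integral in M as [M|M]; [apply Ny, Iy|apply Nx, Ix]; lra.
Qed.

Lemma x_minor : minor_arc a x y h x /\ minor_arc b x y h x.
Proof.
  pose proof (radius_pos X h HX). destruct (coords_x h x y a b Q) as [_ [Bx Gx]].
  split; [apply (minor_arc_of_plane h x y a b Q)|apply (minor_arc_of_plane h x y b a (quad_swap _ _
      _ _ _ Q))];
    rewrite ?(cB_swap x y a b), ?(cG_swap x y a b); try lra; apply Q.
Qed.

Lemma y_minor : minor_arc a x y h y /\ minor_arc b x y h y.
Proof.
  pose proof (radius_pos X h HX). destruct (coords_y h x y a b Q) as [_ [By Gy]].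
  split; [apply (minor_arc_of_plane h x y a b Q)|apply (minor_arc_of_plane h x y b a (quad_swap _ _
      _ _ _ Q))];
    rewrite ?(cB_swap x y a b), ?(cG_swap x y a b); try lra; apply Q.
Qed.

(** A path to a point of negative gap starts on the open edge, where the gap is positive. At a zero
    of the gap it is on one of the two minor arcs, which the path must avoid. *)
Lemma sigma_region_dihedral_gap (p : pt) : sigma_region X h (face_pair a b) x y a b p -> 0 <=
    dihedral_gap p.
Proof.
  intros Hcl. apply Rnot_lt_le; intros Hneg.
  destruct lipschitz_dihedral_gap as [M [HM HL]].
  destruct (Hcl (- dihedral_gap p / M)) as [z [[e [Ie [g [Hg [H0 [H1 HS]]]]]] Hz]].
  { apply Rdiv_lt_0_compat; lra. }
  specialize (HL p z). unfold oball in Hz.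
  apply (Rmult_lt_compat_l M) in Hz; auto.
  replace (M * (- dihedral_gap p / M)) with (- dihedral_gap p) in Hz by (field; lra).
  assert (Hfz : dihedral_gap z < 0).
  { pose proof (Rle_abs (- (dihedral_gap p - dihedral_gap z))). rewrite Rabs_Ropp in *. lra. }
  assert (Hfe : 0 < dihedral_gap e).
  { destruct (HS 0 ltac:(lra)) as [_ [Na Nb]]. rewrite H0 in Na, Nb.
    apply (edge_arc X h HX a b x y) in Ie; auto.
    apply arc_open_dihedral_gap; auto; intros ->; [apply Na, x_minor|apply Na, y_minor]. }
  destruct (path_ivt g dihedral_gap 0 1 Hg lipschitz_dihedral_gap) as [t [Ht E]]; try lra.
  { rewrite H0, H1. nra. }
  destruct (HS t ltac:(lra)) as [Hbd [Na Nb]].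
  apply (boundary_iff X h HX) in Hbd as [Pg [c [Hc Hgc]]].
  destruct (dihedral_boundary (g t) c Pg Hc Hgc E); auto.
Qed.

Lemma arc_top : exists e, upper_arc x y a b e /\ B e = 0 /\ 1 < G e.
Proof.
  pose proof (S_pos h x y a b Q) as HS. pose proof (T_pos h x y a b Q) as HT.
  set (r := sqrt ((sqi x y + sqk x y a b) / sqk x y a b)).
  assert (Hr : r * r = (sqi x y + sqk x y a b) / sqk x y a b)
    by (apply sqrt_sqrt, Rlt_le, Rdiv_lt_0_compat; lra).
  assert (Hr0 : 0 <= r) by apply sqrt_pos.
  assert (Hr2 : sqk x y a b * (r * r) = sqi x y + sqk x y a b) by (rewrite Hr; field; lra).
  assert (Hr1 : 1 < r * r) by nra. assert (1 < r) by nra.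
  destruct (coords_of_coords h x y a b Q 0 0 r) as [EA [EB EG]].
  exists (of_coords x y a b 0 0 r). unfold upper_arc. rewrite EA, EB, EG, Hr2. lra.
Qed.

(** The path is the great-circle arc on the sphere of [a]. By [fan] it stays in every ball, and
    [G + B - 1], which vanishes at [a], is linear on the cone from [a] and positive at both ends. *)
Lemma half_region_path (e p : pt) : upper_arc x y a b e -> B e = 0 -> 1 < G e ->
  Phi p -> sqdist p a = h * h -> 0 < G p + B p - 1 -> 
  exists g, cont_on01 g /\ g 0 = e /\ g 1 = p /\
    forall t, 0 <= t <= 1 -> Phi (g t) /\ sqdist (g t) a = h * h /\ 0 < dihedral_gap (g t).
Proof.
  intros Hex HBe HGe Pp Hpa Hlp. pose proof (radius_pos X h HX) as Hh.
  pose proof (upper_arc_Phi e Hex) as Pe. pose proof (upper_arc_sqdist_a h x y a b Q e Hex) as Hea.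
  assert (Hin : forall q, Phi q -> sqdist q a = h * h -> 0 < G q + B q - 1 -> 0 < dihedral_gap q).
  { intros q Pq Hq Hl. pose proof (B_sign q Hq (Pq b Hb)). unfold dihedral_gap.
  rewrite Rabs_left1; lra. }
  destruct (pt_eq_or_neq e p) as [<-|Nep].
  { exists (fun _ => e). split; [|split; [auto|split; [auto|intros; auto]]].
    intros t _ r Hr. exists 1; split; [lra|]. intros. apply dist_lt_iff; [lra|].
    rewrite sqdist_refl; nra. }
  assert (OK : geo_ok h a e p).
  { apply (geo_ok_intro h a e p (vsub b a)); auto; apply dot_ball; auto. }
  exists (geo h a e p). split; [|split; [now apply geo_0|split; [now apply geo_1|]]].
  - intros t _ r Hr. destruct (geo_cont h a e p t OK r Hr) as [d [Hd HD]].
    exists d; split; auto.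
  - intros t Ht. pose proof (geo_sphere h a e p t OK) as HS.
    pose proof (geo_scale_pos h a e p t OK) as Hk.
    assert (HP : Phi (geo h a e p t)).
    { intros z Hz. unfold geo. apply (fan (h * h)); auto; try nra. }
    split; auto. split; auto. apply Hin; auto.
    unfold geo. set (k := geo_scale h a e p t) in *.
    destruct (coords_comb x y a b a e p (k * (1 - t)) (k * t)) as [_ [-> ->]].
    destruct (coords_a h x y a b Q) as [_ [-> ->]]. rewrite HBe.
    replace (0 + k * (1 - t) * (G e - 0) + k * t * (G p - 0)
       + (1 + k * (1 - t) * (0 - 1) + k * t * (B p - 1)) - 1)
      with (k * ((1 - t) * (G e - 1) + t * (G p + B p - 1))) by ring.
    apply Rmult_lt_0_compat; auto.
    destruct (Rle_lt_dec t (1/2)); nra.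
Qed.

End Edge.

Lemma dihedral_gap_swap (a b x y p : pt) : dihedral_gap b a x y p = dihedral_gap a b x y p.
Proof. unfold dihedral_gap. now rewrite cB_swap, cG_swap, Rabs_Ropp. Qed.

(** The sign of [B] decides which of the spheres of [a] and [b] carries [p]. On it a great-circle
    arc joins [p] to the top of the edge with positive gap, hence off the two minor arcs. *)
Lemma dihedral_gap_sigma_region (a b x y p : pt) : In a X -> In b X -> a <> b -> is_edge X h
    (face_pair a b) x y ->
  boundary (ball_poly X h) p -> 0 < dihedral_gap a b x y p ->
  sigma_region X h (face_pair a b) x y a b p.
Proof.
  intros Ha Hb Hab He Hbd HD. apply (boundary_iff X h HX) in Hbd as [Pp [z [Hz Hpz]]].
  pose proof (edge_quad X h HX a b x y Ha Hb Hab He) as Q.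
  destruct (arc_top a b x y Ha Hb Hab He) as [e [Hex [HBe HGe]]].
  assert (Hpath : exists g, cont_on01 g /\ g 0 = e /\ g 1 = p /\
    forall t, 0 <= t <= 1 -> Phi (g t) /\ (exists c, In c X /\ sqdist (g t) c = h * h) /\
      0 < dihedral_gap a b x y (g t)).
  { destruct (dihedral_face a b x y Ha Hb Hab He p z Pp Hz Hpz) as [H1 H2]; [lra|].
    unfold dihedral_gap in HD. destruct (Rle_lt_dec (cB x y a b p) 0) as [HB|HB].
    - rewrite Rabs_left1 in HD by auto.
      destruct (half_region_path a b x y Ha Hb Hab He e p) as [g [Hg [H0 [H1' HS]]]]; auto; [lra|].
      exists g; repeat split; auto; try apply HS; auto. exists a; split; auto. now apply HS.
    - rewrite Rabs_right in HD by lra.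
      assert (He' : is_edge X h (face_pair b a) x y) by (rewrite face_pair_sym; auto).
      destruct (half_region_path b a x y Hb Ha (not_eq_sym Hab) He' e p) as [g [Hg [H0 [H1' HS]]]];
          auto;
        rewrite ?(cB_swap x y a b), ?(cG_swap x y a b); try lra; auto.
      + now apply upper_arc_swap.
      + exists g; repeat split; auto; try apply HS; auto.
        * exists b; split; auto. now apply HS.
        * rewrite <- dihedral_gap_swap. now apply HS. }
  destruct Hpath as [g [Hg [H0 [H1 HS]]]].
  apply closure_incl. exists e. split; [now apply (edge_arc X h HX a b x y)|].
  exists g. split; [exact Hg|]. split; [exact H0|]. split; [exact H1|].
  intros t Ht. destruct (HS t Ht) as [P1 [P2 P3]].
  split; [now apply (boundary_iff X h HX)|].
  split; intros Hm; pose proof (minor_arc_dihedral_gap a b x y Ha Hb Hab He (g t)); [specialize (H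
      (or_introl Hm))|
    specialize (H (or_intror Hm))]; lra.
Qed.

End Body.

(** * The surgered body *)

Section Surgery.
Variables (X : list pt) (h : R) (C : pset -> Prop).
Hypothesis HX : is_reuleaux X h.
Hypothesis HC : dual_selection X h C.

Notation Phi := (Phi X h).
Notation face_pair := (face_pair X h).

Definition chosen (x y a b : pt) : Prop :=
  In a X /\ In b X /\ a <> b /\ is_edge X h (face_pair a b) x y /\ C (face_pair a b).

(* Vertices together with the unchosen edges, i.e. the duals of the chosen ones *)
Definition centres : pset := fun p =>
  In p X \/ exists x y a b, chosen x y a b /\ face_pair x y p.

Definition surgery_body : pset := hull h centres.

Lemma chosen_dual_arc (x y a b f : pt) : chosen x y a b -> (face_pair x y f <-> upper_arc a b x y
    f).
Proof.
  intros [Ha [Hb [Nab [He _]]]].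
  pose proof (edge_facts X h HX _ _ _ He) as [_ [_ [Nxy [Hx [Hy _]]]]].
  apply (edge_arc X h HX); auto. now apply dual_edge.
Qed.

Lemma chosen_quad (x y a b : pt) : chosen x y a b -> quad h x y a b.
Proof. intros [Ha [Hb [Nab [He _]]]]. now apply (edge_quad X h HX). Qed.

Lemma unchosen_edge (x y a b : pt) : In a X -> In b X -> a <> b -> is_edge X h (face_pair a b) x y
    ->
  ~ C (face_pair a b) -> chosen a b x y.
Proof.
  intros Ha Hb Nab He NC. pose proof (edge_facts X h HX _ _ _ He) as [_ [_ [Nxy [Hx [Hy _]]]]].
  do 3 (split; [assumption|]). split; [now apply dual_edge|].
  assert (HD : dual X h (face_pair a b) (face_pair x y)).
  { exists x, y, a, b. apply (dual_data_iff X h HX).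
    do 4 (split; [assumption|]). split; reflexivity. }
  apply (proj2 HC) in HD. tauto.
Qed.

Lemma not_both_chosen (x y a b : pt) : chosen x y a b -> ~ C (face_pair x y).
Proof.
  intros [Ha [Hb [Nab [He HCab]]]].
  assert (HD : dual X h (face_pair a b) (face_pair x y)).
  { exists x, y, a, b. apply (dual_data_iff X h HX).
    do 4 (split; [assumption|]). split; reflexivity. }
  apply (proj2 HC) in HD. tauto.
Qed.

Lemma centres_Phi (p : pt) : centres p -> Phi p.
Proof.
  intros [Hp|[x [y [a [b [_ Hp]]]]]]; [now apply (X_Phi X h HX)|].
  apply (face_pair_iff X h HX) in Hp; tauto.
Qed.

Lemma surgery_body_Phi (p : pt) : surgery_body p -> Phi p.
Proof. intros Hp c Hc. apply Hp. now left. Qed.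

(** If [p] is beyond the ball of [q] on an unchosen edge [xy], it lies in the dihedral angle of the
    dual chosen edge, where only the spheres of [a] and [b] reach it. The edge of [p] then is this
    chosen edge, yet it should be unchosen. *)
Lemma centres_diam (p q : pt) : centres p -> centres q -> sqdist p q <= h * h.
Proof.
  intros Hp Hq. pose proof (centres_Phi p Hp) as Pp. pose proof (centres_Phi q Hq) as Pq.
  destruct Hq as [Hq|[x [y [a [b [Hch Hq]]]]]]; [now apply Pp|].
  destruct Hp as [Hp|[x' [y' [a' [b' [Hch' Hp]]]]]]; [rewrite sqdist_sym; now apply Pq|].
  apply Rnot_lt_le; intros Hlt.
  pose proof (chosen_quad _ _ _ _ Hch) as Q.
  assert (Hf : upper_arc a b x y q) by now apply (chosen_dual_arc x y a b).
  destruct Hch as [Ha [Hb [Nab [He HCab]]]] eqn:EH; clear EH.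
  pose proof (outside_dual_ball_dihedral h x y a b Q q p Hf (Pp a Ha) (Pp b Hb) Hlt) as HG.
  assert (HD : 0 <= dihedral_gap a b x y p) by (unfold dihedral_gap; lra).
  pose proof (edge_facts X h HX _ _ _ He) as [_ [_ [Nxy [Hx [Hy _]]]]].
  apply (face_pair_iff X h HX) in Hp as [Px' [Py' _]].
  pose proof Hch' as [Ha' [Hb' [Nab' [He' HCab']]]].
  pose proof (edge_facts X h HX _ _ _ He') as [_ [_ [Nxy' [Hx' [Hy' _]]]]].
  assert (HpX : ~ In p X).
  { intros HpX. rewrite sqdist_sym in Hlt. pose proof (Pq p HpX). lra. }
  assert (Hcase : forall z, In z X -> sqdist p z = h * h -> z = a \/ z = b).
  { intros z Hz Hpz. destruct (dihedral_spheres X h HX a b x y Ha Hb Nab He p z Pp Hz Hpz HD)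
      as [H|[H|[H|H]]]; auto; subst; tauto. }
  apply (not_both_chosen _ _ _ _ Hch').
  destruct (Hcase x' Hx' Px') as [->| ->], (Hcase y' Hy' Py') as [->| ->]; try congruence.
  now rewrite face_pair_sym.
Qed.

Lemma centres_K (p : pt) : centres p -> surgery_body p.
Proof. intros Hp c Hc. now apply centres_diam. Qed.

Lemma wedge_K (x y a b f p : pt) : chosen x y a b -> face_pair x y f -> minor_arc f x y h p ->
  surgery_body p /\ sqdist p f = h * h.
Proof.
  intros Hch Hf Hm. pose proof (radius_pos X h HX) as Hh.
  destruct Hch as [Ha [Hb [Nab [He HCab]]]] eqn:EH; clear EH.
  pose proof (edge_facts X h HX _ _ _ He) as [_ [_ [Nxy [Hx [Hy _]]]]].
  pose proof Hf as Hf'. apply (face_pair_iff X h HX) in Hf' as [Fx [Fy _]].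
  rewrite sqdist_sym in Fx; rewrite sqdist_sym in Fy. pose proof (X_diam X h HX x y Hx Hy) as Hxy.
  split.
  - intros c Hc. apply (minor_arc_fan h f x y c p); auto; apply centres_diam; auto; now left.
  - apply (minor_arc_elim h f x y p); auto.
Qed.

(** Inside the angle some point of the dual edge is farther from [p] than both [a] and [b], and its
    ball cuts [p] off. *)
Lemma surgery_body_dihedral_gap (x y a b p : pt) : chosen x y a b -> surgery_body p -> sqdist p a =
    h * h \/ sqdist p b = h * h ->
  dihedral_gap a b x y p <= 0.
Proof.
  intros Hch Kp Hab. apply Rnot_lt_le; intros Hlt. pose proof (chosen_quad _ _ _ _ Hch) as Q.
  destruct (dihedral_farther_from_dual h x y a b Q p) as [f [Hf [H1 H2]]]; [unfold dihedral_gap in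
      Hlt; lra|].
  assert (sqdist p f <= h * h); [|lra]. apply Kp. right. exists x, y, a, b. split; auto.
  now apply (chosen_dual_arc x y a b).
Qed.

(** Compactness for infinitely many balls: each dual arc has a point farthest from [p], which yields
    a margin for the arc, and the arcs are indexed by pairs of vertices, finite in number. *)
Lemma surgery_body_touch (p : pt) : surgery_body p -> ~ interior surgery_body p -> exists c,
    centres c /\ sqdist p c = h * h.
Proof.
  intros Kp Hni. pose proof (radius_pos X h HX) as Hh. apply NNPP; intros Hn. apply Hni.
  assert (Hlt : forall c, centres c -> sqdist p c < h * h).
  { intros c Hc. destruct (Rle_lt_or_eq_dec _ _ (Kp c Hc)); auto. exfalso; eauto. }
  set (P := fun x y e => (exists a b, chosen x y a b) -> forall f, face_pair x y f ->
     forall z, dist p z < e -> sqdist z f <= h * h).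
  assert (HP : exists e, 0 < e /\ forall x, In x X -> forall y, In y X -> P x y e).
  { apply (list_margin (fun x e => forall y, In y X -> P x y e)).
    - intros c e e' _ Hle H y Hy Hc f Hf z Hz. apply (H y Hy Hc f Hf). lra.
    - intros x Hx. apply (list_margin (fun y e => P x y e)).
      + intros y e e' _ Hle H Hc f Hf z Hz. apply (H Hc f Hf). lra.
      + intros y Hy. destruct (classic (exists a b, chosen x y a b)) as [[a [b Hch]]|Hno].
        * assert (Harc : is_arc (face_pair x y) a b).
          { destruct Hch as [Ha [Hb [Nab [He HCab]]]]. apply (dual_edge X h HX); auto. }
          destruct (arc_farthest _ _ _ p Harc) as [f0 [Hf0 Hmax]].
          assert (H0 : sqdist p f0 < h * h).
          { apply Hlt. right. exists x, y, a, b. auto. }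
          apply dist_lt_iff in H0; [|lra].
          exists (h - dist p f0). split; [lra|]. intros _ f Hf z Hz.
          specialize (Hmax f Hf). rewrite <- (dist_sqdist p f0) in Hmax.
          apply dist_le_iff in Hmax; [|apply dist_nonneg].
          apply dist_le_iff; [lra|]. apply (dist_shrink h p z f). lra.
        * exists 1; split; [lra|]. intros Hc; now apply Hno in Hc. }
  destruct HP as [e1 [He1 H1]]. destruct (finite_strict_margin X h p Hh) as [e2 [He2 H2]].
  exists (Rmin e1 e2). split; [now apply Rmin_pos|].
  pose proof (Rmin_l e1 e2); pose proof (Rmin_r e1 e2).
  intros z Hz c Hc. unfold oball in Hz. pose proof Hc as [HcX|[x [y [a [b [Hch Hc']]]]]].
  - apply Rlt_le, (H2 c HcX); auto; lra.
  - pose proof Hch as [Ha [Hb [Nab [He HCab]]]].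
    pose proof (edge_facts X h HX _ _ _ He) as [_ [_ [Nxy [Hx [Hy _]]]]].
    apply (H1 x Hx y Hy); eauto. lra.
Qed.

Lemma wedge_of_touch (x y a b f p : pt) : chosen x y a b -> face_pair x y f -> ~ In f X ->
    surgery_body p ->
  sqdist p f = h * h -> minor_arc f x y h p.
Proof.
  intros Hch Hf NfX Kp Hpf. pose proof (chosen_quad _ _ _ _ Hch) as Q.
  apply (dual_contact_minor_arc h x y a b Q); auto.
  - now apply (chosen_dual_arc x y a b).
  - intros ->. apply NfX, Hch.
  - intros ->. apply NfX, Hch.
  - intros f' Hf'. apply Kp. right. exists x, y, a, b. split; auto.
  now apply (chosen_dual_arc x y a b).
Qed.

(* The great circle from a vertex [v] of the face of [c] through [p] leaves the face at [p'].
   If the edge hit there is unchosen, [p'] is a centre; otherwise [p] lies before the point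
   [w] where the great circle meets the minor arc cutting off the removed region. *)
Lemma face_point_diam (c p q : pt) : In c X -> surgery_body p -> sqdist p c = h * h -> surgery_body
    q -> sqdist p q <= h * h.
Proof.
  intros Hc Kp Hpc Kq. pose proof (radius_pos X h HX) as Hh. assert (Hhh : 0 < h * h) by nra.
  assert (HqC : forall u, centres u -> sqdist u q <= h * h) by (intros u Hu; rewrite sqdist_sym;
      auto).
  destruct (X_neighbour X h HX c Hc) as [v [Hv Hvc]].
  assert (Cv : centres v) by now left.
  destruct (pt_eq_or_neq p v) as [->|Npv]; [auto|].
  destruct (shoot X h HX c v p Hc (surgery_body_Phi p Kp) Hpc Hv Hvc Npv)
    as [z [p' [l [m [Hz [Nzc [Hp' [Hl [Hm Ep]]]]]]]]].
  pose proof Hp' as Hp''. apply (face_pair_iff X h HX) in Hp'' as [P'c [P'z P'P]].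
  assert (Hfan : centres p' -> sqdist p q <= h * h).
  { intros Cp'. rewrite Ep. apply (fan (h * h)); auto; [lra|]. now rewrite <- Ep. }
  destruct (classic (In p' X)) as [Hin|Hnin]; [apply Hfan; now left|].
  destruct (edge_of_nonvertex X h HX c z p' Hc Hz (not_eq_sym Nzc) Hp' Hnin) as [x [y He]].
  destruct (classic (C (face_pair c z))) as [HCc|HCc].
  2:{ apply Hfan. right. exists c, z, x, y. split; auto. apply unchosen_edge; auto. }
  assert (Hch : chosen x y c z) by (do 4 (split; [auto|]); auto).
  pose proof (chosen_quad _ _ _ _ Hch) as Q.
  pose proof (edge_facts X h HX _ _ _ He) as [_ [_ [Nxy [Hx [Hy _]]]]].
  pose proof (surgery_body_dihedral_gap x y c z p Hch Kp (or_introl Hpc)) as HfD.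
  assert (HB : cB x y c z p <= 0).
  { apply (B_sign X h HX c z x y); auto. apply Kp; now left. }
  unfold dihedral_gap in HfD. rewrite Rabs_left1 in HfD by auto.
  assert (HB' : cB x y c z p' = 0 /\ 1 < cG x y c z p').
  { apply (edge_arc X h HX c z x y) in Hp'; auto.
    assert (HfD' : 0 < dihedral_gap c z x y p').
    { apply (arc_open_dihedral_gap X h HX c z x y); auto; intros ->; auto. }
    destruct Hp' as [HB' _]. unfold dihedral_gap in HfD'. rewrite HB', Rabs_R0 in HfD'. split; lra.
    }
  destruct HB' as [HB' HG'].
  (* [L] vanishes on the plane through [c], [x], [y]; [p] and [p'] lie on opposite sides *)
  set (Lp := cG x y c z p' + cB x y c z p' - 1).
  set (Lv := cG x y c z v + cB x y c z v - 1).
  destruct (coords_a h x y c z Q) as [_ [Bc Gc]].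
  assert (HLp : 0 < Lp) by (unfold Lp; lra).
  assert (Hrel : l * Lv + m * Lp <= 0).
  { destruct (coords_comb x y c z c v p' l m) as [_ [EB EG]]. rewrite <- Ep in EB, EG.
    rewrite Bc in EB; rewrite Gc in EG. unfold Lv, Lp.
    assert (E : cG x y c z p + cB x y c z p - 1 = l * (cG x y c z v + cB x y c z v - 1) +
      m * (cG x y c z p' + cB x y c z p' - 1)) by (rewrite EB, EG; ring). lra. }
  assert (HmL : 0 < m * Lp) by nra.
  assert (HLv : Lv < 0) by nra.
  assert (Ncz : c <> z) by auto.
  assert (Nz : forall u, sqdist u c = h * h -> sqdist u z <= h * h -> 0 < dot (vsub z c) (vsub u c))
    by (intros u; now apply (dot_ball h)).
  assert (Hvz : sqdist v z <= h * h) by now apply (X_diam X h HX).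
  (* The weights [Lp] and [- Lv] are those for which [L] vanishes at [w]. *)
  destruct (push_to_sphere h c v p' (vsub z c) Lp (- Lv)) as [k [Hk Hw]]; auto; try lra.
  set (w := comb c v p' (k * Lp) (k * - Lv)) in *.
  assert (Hwz : sqdist w z <= h * h).
  { unfold w. apply (fan (h * h)); auto; try nra; lra. }
  pose proof (B_sign X h HX c z x y Hc Hz Ncz He w Hw Hwz) as HBw.
  assert (HGw : cG x y c z w = 1 - cB x y c z w).
  { destruct (coords_comb x y c z c v p' (k * Lp) (k * - Lv)) as [_ [EB EG]]. fold w in EB, EG.
    rewrite EB, EG, Bc, Gc. unfold Lp, Lv. ring. }
  pose proof (minor_arc_of_plane h x y c z Q w Hw HBw HGw) as Hmin.
  destruct Q as [_ [_ [_ [Hxy [_ [Hxc [_ [Hyc _]]]]]]]].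
  assert (Hwq : sqdist w q <= h * h).
  { apply (minor_arc_fan h c x y q w); auto; apply HqC; now left. }
  (* [p'] is eliminated in favour of [w]. The new coefficient of [v] is nonnegative by [Hrel], which
     says that [p] is on the side of [v]. *)
  assert (Ep2 : p = comb c v w (l - m * Lp / - Lv) (m / (k * - Lv))).
  { rewrite Ep. unfold w.
    assert (E1 : l - m * Lp / - Lv + m / (k * - Lv) * (k * Lp) = l) by (field; lra).
    assert (E2 : m / (k * - Lv) * (k * - Lv) = m) by (field; lra).
    transitivity (comb c v p' (l - m * Lp / - Lv + m / (k * - Lv) * (k * Lp))
      (m / (k * - Lv) * (k * - Lv))); [now rewrite E1, E2|].
    generalize (l - m * Lp / - Lv) (m / (k * - Lv)) (k * Lp) (k * - Lv). clear. veq. }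
  rewrite Ep2. apply (fan (h * h)); auto.
  - assert (m * Lp / - Lv <= l); [|lra].
    apply Rmult_le_reg_r with (- Lv); [lra|]. unfold Rdiv. rewrite Rmult_assoc, Rinv_l; lra.
  - apply Rle_mult_inv_pos; [lra|nra].
  - now rewrite <- Ep2.
Qed.

Lemma boundary_point_diam (p q : pt) : surgery_body p -> ~ interior surgery_body p -> surgery_body
    q -> sqdist p q <= h * h.
Proof.
  intros Kp Hni Kq. pose proof (radius_pos X h HX) as Hh.
  destruct (surgery_body_touch p Kp Hni) as [c [Hc Hpc]].
  destruct (classic (In c X)) as [HcX|HcX]; [now apply (face_point_diam c)|].
  destruct Hc as [Hc|[x [y [a [b [Hch Hc]]]]]]; [tauto|].
  pose proof (wedge_of_touch x y a b c p Hch Hc HcX Kp Hpc) as Hm.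
  pose proof Hch as [Ha [Hb [Nab [He HCab]]]].
  pose proof (edge_facts X h HX _ _ _ He) as [_ [_ [Nxy [Hx [Hy _]]]]].
  apply (face_pair_iff X h HX) in Hc as [Fx [Fy _]].
  rewrite sqdist_sym in Fx; rewrite sqdist_sym in Fy.
  apply (minor_arc_fan h c x y q p); auto; try now apply (X_diam X h HX).
  all: rewrite sqdist_sym; apply Kq; now left.
Qed.

(** Prolonging the segment from [q] through [p] until it leaves the body gives a boundary point at
    least as far from [q] as [p] is. *)
Lemma surgery_body_diam (p q : pt) : surgery_body p -> surgery_body q -> sqdist p q <= h * h.
Proof.
  intros Kp Kq. pose proof (radius_pos X h HX) as Hh. apply Rnot_lt_le; intros Hlt.
  destruct (X_distinct X h HX) as [c [_ [Hc _]]].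
  set (r := fun t => vadd p (vscal t (vsub p q))).
  assert (Hr : forall s t, dist (r t) (r s) = Rabs (s - t) * dist p q).
  { intros s t. apply dist_eq_iff.
    - apply Rmult_le_pos; [apply Rabs_pos|apply dist_nonneg].
    - replace (Rabs (s - t) * dist p q * (Rabs (s - t) * dist p q))
        with (Rabs (s - t) * Rabs (s - t) * (dist p q * dist p q)) by ring.
      rewrite dist_sqdist, <- Rabs_mult, Rabs_right by apply Rle_ge, Rle_0_sqr.
      unfold r; clear; vring. }
  assert (Hrq : forall t, sqdist (r t) q = (1 + t) * (1 + t) * sqdist p q) by (intros; unfold r;
      clear; vring).
  assert (Hd : h < dist p q).
  { apply Rnot_le_lt; intros H. apply dist_le_iff in H; lra. }
  destruct (last_exit (fun t => surgery_body (r t)) 1) as [T [HT [KT Hex]]].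
  - intros t Hn. destruct (hull_open_compl h _ _ Hh Hn) as [e [He HE]].
    exists (e / dist p q). split; [apply Rdiv_lt_0_compat; lra|].
    intros s Hs. apply HE. rewrite Hr. apply (Rmult_lt_compat_r (dist p q)) in Hs; [|lra].
    unfold Rdiv in Hs. rewrite Rmult_assoc, Rinv_l in Hs; lra.
  - lra.
  - replace (r 0) with p; auto. unfold r; clear; veq.
  (* [r 1] is twice as far from [q] as [p], more than [2 h], whereas points of the body lie within
     [h] of [c]. *)
  - intros HK. pose proof (HK c (or_introl Hc)) as H1. pose proof (Kq c (or_introl Hc)) as H2.
    apply dist_le_iff in H1; [|lra]. apply dist_le_iff in H2; [|lra].
    pose proof (dist_triangle (r 1) c q) as H3. rewrite (dist_sym c q) in H3.
    assert (H4 : sqdist (r 1) q <= (h + h) * (h + h)) by (apply dist_le_iff; lra).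
    rewrite Hrq in H4. nra.
  - assert (sqdist (r T) q <= h * h).
    { apply boundary_point_diam; auto. intros [e [He HI]].
      destruct (Hex (e / dist p q)) as [s [Hs Hns]]; [apply Rdiv_lt_0_compat; lra|].
      apply Hns, HI. unfold oball. rewrite Hr, Rabs_right by lra.
      assert (H : s - T < e / dist p q) by lra.
      apply (Rmult_lt_compat_r (dist p q)) in H; [|lra].
      unfold Rdiv in H. rewrite Rmult_assoc, Rinv_l in H; lra. }
    rewrite Hrq in H. pose proof (sqdist_nonneg p q). nra.
Qed.

Lemma surgery_body_convex_body : convex_body surgery_body.
Proof.
  pose proof (radius_pos X h HX) as Hh. destruct (X_distinct X h HX) as [c [v [Hc [Hv Ncv]]]].
  split; [apply hull_convex|]. split; [intros p; now apply hull_closed|]. split.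
  - exists (h + dist c vzero). intros p Kp.
    assert (E : vnorm p = dist p vzero) by (unfold dist; f_equal; clear; veq).
    specialize (Kp c (or_introl Hc)). apply dist_le_iff in Kp; [|lra].
    pose proof (dist_triangle p c vzero). lra.
  (* By Stewart's theorem the midpoint of two vertices is within [sqrt (h * h - d / 4) < h] of every
     centre, so a whole neighbourhood is in the body. *)
  - exists (seg c v (1/2)). set (d := sqdist c v). assert (Hd : 0 < d) by now apply sqdist_pos.
    assert (Hdh : d <= h * h) by now apply (X_diam X h HX).
    assert (H0 : 0 <= h * h - d / 4) by lra.
    set (r := sqrt (h * h - d / 4)).
    assert (Hr0 : 0 <= r) by apply sqrt_pos.
    assert (Hr : r * r = h * h - d / 4) by now apply sqrt_sqrt.
    assert (Hrh : r < h) by nra.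
    exists (h - r). split; [lra|]. intros z Hz w Hw. unfold oball in Hz.
    apply dist_le_iff; [lra|]. apply (dist_shrink h (seg c v (1/2))).
    assert (dist (seg c v (1/2)) w <= r); [|lra].
    apply dist_le_iff; auto. rewrite Hr, sqdist_seg.
    assert (sqdist c w <= h * h) by (apply centres_diam; auto; now left).
    assert (sqdist v w <= h * h) by (apply centres_diam; auto; now left). fold d. lra.
Qed.

(** A contact with a ball centred inside a dual edge is a wedge point. A contact with the ball of a
    vertex is an old boundary point, which can meet a removed region only along its two bounding
    arcs; these belong to the wedge, being centred at the ends of the dual edge. *)
Lemma surgery_body_boundary (p : pt) : boundary surgery_body p <-> surgered X h C p.
Proof.
  pose proof (radius_pos X h HX) as Hh. split.
  - intros Hb. pose proof (boundary_hull_in _ _ _ Hh Hb) as Kp. destruct Hb as [_ Hni].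
    destruct (surgery_body_touch p Kp Hni) as [c [Hc Hpc]].
    destruct (classic (In c X)) as [HcX|HcX].
    + destruct (classic (exists E x y F a b, C E /\ dual_data X h E x y F a b /\
         sigma_region X h E x y a b p)) as [[E [x [y [F [a [b [HE [HD HS]]]]]]]]|Hno].
      * right. exists E, x, y, F, a, b. split; auto. split; auto.
        apply (dual_data_iff X h HX) in HD as [Ha [Hb [Nab [He [-> ->]]]]].
        assert (Hch : chosen x y a b) by (do 4 (split; [auto|]); auto).
        apply (sigma_region_dihedral_gap X h HX) in HS; auto.
        pose proof (edge_facts X h HX _ _ _ (dual_edge X h HX a b x y Ha Hb Nab He))
          as [Ia [Ib _]].
        (* With [HS] this makes the gap zero, so [p] is on one of the two minor arcs. *)
        assert (H0 : dihedral_gap a b x y p <= 0).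
        { apply surgery_body_dihedral_gap; auto.
          destruct (dihedral_face X h HX a b x y Ha Hb Nab He p c (surgery_body_Phi p Kp) HcX Hpc
              HS) as [H1 H2].
          destruct (Rle_lt_dec (cB x y a b p) 0); [left|right]; auto with real. }
        destruct (dihedral_boundary X h HX a b x y Ha Hb Nab He p c (surgery_body_Phi p Kp) HcX
            Hpc) as [Hm|Hm];
          [lra|exists a|exists b]; auto.
      * left. split; [apply (boundary_iff X h HX); split; [now apply surgery_body_Phi|eauto]|].
        intros E x y F a b HE HD HS. apply Hno. exists E, x, y, F, a, b. auto.
    + destruct Hc as [Hc|[x [y [a [b [Hch Hc]]]]]]; [tauto|].
      right. exists (face_pair a b), x, y, (face_pair x y), a, b.
      split; [apply Hch|]. split.
      * apply (dual_data_iff X h HX). destruct Hch as [Ha [Hb [Nab [He HCab]]]].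
        do 4 (split; [assumption|]). split; reflexivity.
      * exists c. split; auto. now apply (wedge_of_touch x y a b).
  - intros [[Hbd Hno]|[E [x [y [F [a [b [HE [HD [f [Hf Hm]]]]]]]]]]].
    + pose proof Hbd as Hbd'. apply (boundary_iff X h HX) in Hbd' as [Pp [c [Hc Hpc]]].
      apply hull_sphere_boundary with c; auto; [|now left].
      intros f Hf. destruct Hf as [Hf|[x [y [a [b [Hch Hf]]]]]]; [now apply Pp|].
      apply Rnot_lt_le; intros Hlt.
      apply (chosen_dual_arc x y a b f Hch) in Hf.
      pose proof (chosen_quad _ _ _ _ Hch) as Q.
      pose proof Hch as [Ha [Hb [Nab [He HCab]]]].
      pose proof (outside_dual_ball_dihedral h x y a b Q f p Hf (Pp a Ha) (Pp b Hb) Hlt) as HG.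
      apply (Hno (face_pair a b) x y (face_pair x y) a b HCab).
      * apply (dual_data_iff X h HX). do 4 (split; [assumption|]). split; reflexivity.
      * apply dihedral_gap_sigma_region; auto. unfold dihedral_gap; lra.
    + apply (dual_data_iff X h HX) in HD as [Ha [Hb [Nab [He [-> ->]]]]].
      assert (Hch : chosen x y a b) by (do 4 (split; [auto|]); auto).
      destruct (wedge_K x y a b f p Hch Hf Hm) as [Kp Hpf].
      apply hull_sphere_boundary with f; auto. right. exists x, y, a, b. auto.
Qed.

End Surgery.

Theorem theorem5 (X : list pt) (h : R) (C : pset -> Prop) :
  is_reuleaux X h -> dual_selection X h C ->
  exists K : pset, convex_body K /\ constant_width K h /\
    (forall p, boundary K p <-> surgered X h C p).
Proof.
  intros HX HC. exists (surgery_body X h C). split; [now apply surgery_body_convex_body|]. split.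
  - apply complete_constant_width; [now apply (radius_pos X h)|now apply centres_K|].
    intros p q; now apply surgery_body_diam.
  - intros p; now apply surgery_body_boundary.
Qed.
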